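(* Let $X$ be a compact metric space, $T:X\to X$ a homeomorphism, $\mu$ a $T$-ergodic Borel probability measure on $X$ with $\operatorname{supp}\mu=X$, and $f\in C(X,\mathbb{R})$. Let $\nu$ be a compactly supported Borel probability measure on $\mathbb{R}$ whose topological support $S=\operatorname{supp}\nu$ satisfies $\#S\ge 2$. Let $\Sigma_0$ be the $\mu$-almost sure spectrum of the operators $H_x$, and let $\Sigma_1$ be the $\mu\times\nu^{\mathbb{Z}}$-almost sure spectrum of the operators $H_x+W_\omega$ (all as defined in the context). Assume that $X$ is connected. Then $$\Sigma_1=\Sigma_0\bigstar S .$$
   Context: For $x\in X$ put $V_x(n)=f(T^nx)$, $n\in\mathbb{Z}$, and let $H_x$ be the bounded self-adjoint operator in $\ell^2(\mathbb{Z})$ given by $[H_x\psi](n)=\psi(n+1)+\psi(n-1)+V_x(n)\psi(n)$. By general theory there is a compact set $\Sigma_0\subset\mathbb{R}$ with $\sigma(H_x)=\Sigma_0$ for $\mu$-almost every $x\in X$. Let $\Omega=S^{\mathbb{Z}}$, $\tilde\mu=\nu^{\mathbb{Z}}$, and for $\omega\in\Omega$ let $W_\omega$ be the multiplication operator by the potential $W_\omega(n)=\omega_n$, $n\in\mathbb{Z}$. The measure $\mu\times\tilde\mu$ is ergodic with respect to the product of $T$ and the left shift, and by general theory there is a compact set $\Sigma_1\subset\mathbb{R}$ with $\sigma(H_x+W_\omega)=\Sigma_1$ for $\mu\times\tilde\mu$-almost every $(x,\omega)\in X\times\Omega$. For compact subsets $A,B$ of $\mathbb{R}$ define $A\bigstar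 B$ as follows: if $\operatorname{diam}(A)\ge\operatorname{diam}(B)$, then $A\bigstar B=A+\mathrm{ch}(B)$; if $\operatorname{diam}(A)<\operatorname{diam}(B)$, then $A\bigstar B=\mathrm{ch}(A)+B$. Here $\operatorname{diam}$ is the diameter, $\mathrm{ch}$ is the convex hull, and $S_1+S_2=\{s_1+s_2: s_1\in S_1,\ s_2\in S_2\}$ is the Minkowski sum. *)

(* Defs.v *)
From HB Require Import structures.
From mathcomp Require Import all_boot all_order all_algebra.
From mathcomp Require Import all_classical all_reals all_analysis.
From mathcomp Require Import complex.

Set Implicit Arguments.
Unset Strict Implicit.
Unset Printing Implicit Defensive.

Import Order.TTheory GRing.Theory Num.Theory.
Import numFieldNormedType.Exports.
Import ComplexField.Normc.

Local Open Scope classical_set_scope.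
Local Open Scope ring_scope.

(* measurableType requires a chosen point, hence so does a metric space that is
   to carry its Borel sigma-algebra; any space carrying a probability measure is
   nonempty, so the choice of a point is no restriction. *)
#[short(type="pmetricType")]
HB.structure Definition PointedMetric (K : numDomainType) :=
  {M of Metric K M & Pointed M}.

Definition borel {R : numDomainType} (X : pmetricType R) :=
  g_sigma_algebraType (@open X).

Definition homeomorphism (X : topologicalType) (T Tinv : X -> X) : Prop :=
  [/\ cancel T Tinv, cancel Tinv T, continuous T & continuous Tinv].

(* T^n for n in Z; note that Negz k is the integer - (k + 1). *)
Definition iterz (X : Type) (T Tinv : X -> X) (n : int) (x : X) : X :=
  match n with
  | Posz k => iter k T x
  | Negz k => iter k.+1 Tinv x
  end.

Definition ergodic d (X : measurableType d) (R : realType)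
    (mu : set X -> \bar R) (T : X -> X) : Prop :=
  [/\ measurable_fun [set: X] T,
      forall A, measurable A -> mu (T @^-1` A) = mu A &
      forall A, measurable A -> T @^-1` A = A -> mu A = 0%E \/ mu A = 1%E].

Definition msupport (X : topologicalType) (R : realType) (m : set X -> \bar R) :
    set X :=
  [set x | forall U, open U -> U x -> (0 < m U)%E].

Lemma msupport_neq0 (R : realType) (nu : probability (measurableTypeR R) R) :
  msupport nu !=set0.
Proof.
apply: contrapT => /set0P/negP/negPn/eqP nu0.
have loc0 (x : R) : exists U : set R, [/\ open U, U x & nu.-negligible U].
  have /existsNP[U] : ~ msupport nu x by rewrite nu0.
  move=> /not_implyP[oU /not_implyP[Ux /negP]]; rewrite -leNgt => nuU.
  exists U; split=> //; exists U; split=> //; first exact: measurable_realfun.open_measurable.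
  by apply/eqP; rewrite -measure_le0.
have /choice[U UP] := loc0.
have seg0 (n : nat) : nu.-negligible `[- n%:R, n%:R].
  have := @segment_compact R (- n%:R) n%:R; rewrite compact_cover.
  move=> /(_ R setT U) []; first by move=> x _; have [] := UP x.
    by move=> x _; exists x => //; have [] := UP x.
  move=> D _ segD; apply: (@negligibleS _ _ _ nu _ _ segD); rewrite /cover bigcup_fset.
  elim/big_ind: _ => [|A B nA nB|x _]; first exact: negligible_set0.
    exact: negligibleU.
  by have [] := UP x.
have : nu.-negligible [set: R].
  apply: (@negligibleS _ _ _ nu _ _ _ (negligible_bigcup seg0)) => x _.
  exists (Num.bound `|x|) => //=; rewrite in_itv/= -ler_norml.
  by rewrite ltW// archi_boundP.
move=> /(measure_negligible measurableT) nuT0.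
have := probability_setT nu; rewrite [X in X = _]nuT0 => /esym/eqP.
by rewrite onee_eq0.
Qed.

Definition seqspace (R : realType) (nu : probability (measurableTypeR R) R) :
    Type :=
  int -> msupport nu.

HB.instance Definition _ (R : realType)
    (nu : probability (measurableTypeR R) R) :=
  gen_eqMixin (seqspace nu).
HB.instance Definition _ (R : realType)
    (nu : probability (measurableTypeR R) R) :=
  gen_choiceMixin (seqspace nu).
HB.instance Definition _ (R : realType)
    (nu : probability (measurableTypeR R) R) :=
  isPointed.Build (seqspace nu)
    (fun=> SigSub (mem_set (projT2 (cid (msupport_neq0 nu))))).

Definition coord_sets (R : realType) (nu : probability (measurableTypeR R) R) :
    set_system (seqspace nu) :=
  [set C | exists (n : int) (A : set (measurableTypeR R)),
    measurable A /\ C = [set w : seqspace nu | A (\val (w n))]].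

Definition Omega (R : realType) (nu : probability (measurableTypeR R) R) :=
  g_sigma_algebraType (@coord_sets R nu).

(* By the pi-lambda theorem at most one probability measure P on Omega nu
   satisfies this; nu itself, rather than its restriction to S, appears on the
   right because nu is carried by S. *)
Definition is_product_measure (R : realType)
    (nu : probability (measurableTypeR R) R) (P : set (Omega nu) -> \bar R) :
    Prop :=
  forall (J : seq int) (A : int -> set (measurableTypeR R)),
    uniq J -> (forall j, measurable (A j)) ->
    P [set w : seqspace nu | forall j, j \in J -> A j (\val (w j))] =
    (\prod_(j <- J) nu (A j))%E.

Definition sum_sq (R : realType) (psi : int -> R[i]) : \bar R :=
  \esum_(n in [set: int]) (normc (psi n) ^+ 2)%:E.

Definition l2 (R : realType) : set (int -> R[i]) :=
  [set psi | (sum_sq psi < +oo)%E].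

Definition l2norm (R : realType) (psi : int -> R[i]) : R :=
  Num.sqrt (fine (sum_sq psi)).

(* Operators are maps on all sequences; only their action on l2 matters. *)
Definition bounded_operator (R : realType)
    (A : (int -> R[i]) -> (int -> R[i])) : Prop :=
  [/\ forall psi, l2 psi -> l2 (A psi),
      forall (a : R[i]) psi phi, l2 psi -> l2 phi ->
        A (a *: psi + phi) = a *: A psi + A phi &
      exists M : R, forall psi, l2 psi -> l2norm (A psi) <= M * l2norm psi].

Definition resolvent_set (R : realType)
    (H : (int -> R[i]) -> (int -> R[i])) : set R[i] :=
  [set z | exists B, bounded_operator B /\
    forall psi, l2 psi -> B (H psi - z *: psi) = psi /\
                          H (B psi) - z *: B psi = psi].

Definition spectrum (R : realType)
    (H : (int -> R[i]) -> (int -> R[i])) : set R[i] :=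
  ~` resolvent_set H.

Definition mul_op (R : realType) (V : int -> R) (psi : int -> R[i]) :
    int -> R[i] :=
  fun n => (V n)%:C%C * psi n.

Definition schrodinger (R : realType) (V : int -> R) (psi : int -> R[i]) :
    int -> R[i] :=
  fun n => psi (n + 1) + psi (n - 1) + (V n)%:C%C * psi n.

Definition H_ (R : realType) (X : Type) (T Tinv : X -> X) (f : X -> R) (x : X) :
    (int -> R[i]) -> (int -> R[i]) :=
  schrodinger (fun n => f (iterz T Tinv n x)).

Definition W_ (R : realType) (nu : probability (measurableTypeR R) R)
    (w : Omega nu) : (int -> R[i]) -> (int -> R[i]) :=
  mul_op (fun n => \val (w n)).

(* The spectrum is a set of complex numbers; that it equals the image of a set of
   reals says in particular that it is real. *)
Definition is_as_spectrum d (Y : measurableType d) (R : realType)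
    (P : set Y -> \bar R) (H : Y -> (int -> R[i]) -> (int -> R[i]))
    (Sigma : set R) : Prop :=
  compact Sigma /\
  {ae P, forall y, spectrum (H y) = [set E%:C%C | E in Sigma]}.

Definition diam (R : realType) (A : set R) : R :=
  sup [set `|a - b| | a in A & b in A].

Definition ch (R : realType) (A : set R) : set R :=
  smallest (@convex_set R R^o) A.

Definition minkowski_sum (R : realType) (A B : set R) : set R :=
  [set a + b | a in A & b in B].

Definition bigstar (R : realType) (A B : set R) : set R :=
  if diam B <= diam A then minkowski_sum A (ch B) else minkowski_sum (ch A) B.

(* Main.v *)
Require Import Defs.
From HB Require Import structures.
From mathcomp Require Import all_boot all_order all_algebra.
From mathcomp Require Import all_classical all_reals all_analysis.
From mathcomp Require Import complex.
From mathcomp Require Import ring lra zify.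

(** Write S for the support of nu and H_x + W for the operators with potentials
    f (T^n x) + w_n, where w takes its values in S.

    The inclusion of Sigma1 in the star sum is perturbation theory. The operator
    W differs from the midpoint of ch S by at most diam S / 2 in norm, so
    Sigma1 lies in Sigma0 + ch S; exchanging the roles of H_x and W, it also lies
    in ch Sigma0 + S.

    For the other inclusion, let E be outside Sigma1. Since mu has full support,
    and nu has full support in S, all the operators H_x + W - E, with x in X and
    w in S^Z, are bounded below by one and the same constant ([gap_of_spectrum]).
    Take a < b in S, put t = b - a and let A = H_x + a - E. Raising the value at
    one site from a to b is a rank-one perturbation, during which either no
    eigenvalue or exactly one crosses 0; which one it is depends on the sign
    of alpha = 1 + t G(n, n), where G is the Green function before the change
    ([neg_flip]). As alpha is continuous in x and never 0, its sign does not
    depend on x because X is connected ([neg_flip_cst]). Hence it is a function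
    of the configuration of letters alone, and this function is invariant under
    translations of the sites, depends (up to an arbitrary accuracy) on finitely
    many sites only, and gives totals that do not depend on the order in which
    sites are flipped ([neg_flip_exchange]). Such a function is constant
    ([flip_count_constant]): filling an interval site by site, the number of
    crossings per site tends to the value next to a filled half-line, which is
    0 or 1. If it is 0, the total for a long interval is a constant C; two
    distant copies of the interval have the total 2 C and lie in a longer
    interval with total C, so that C = 0. The case of 1 is symmetric.

    The principal minors of 1 + t A^-1 are products of the numbers alpha along
    successive flips. So this operator is positive if no flip makes a crossing
    and negative definite if all do; in other words A (A + t) >= 0 or
    A (A + t) <= 0 ([cross_form_sign]). In the first case Sigma0 does not meet
    (E - b, E - a), in the second one it is contained in this interval
    ([spectrum_gap_dichotomy]). Also, Sigma0 contains no E - s with s in S, by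
    constant sequences w. Comparing the diameters of Sigma0 and S, these facts
    exclude that E is in the star sum. *)

Set Implicit Arguments.
Unset Strict Implicit.
Unset Printing Implicit Defensive.

Import Order.TTheory GRing.Theory Num.Theory.
Import numFieldNormedType.Exports.
Import ComplexField.Normc.

Local Open Scope classical_set_scope.
Local Open Scope ring_scope.

(** * Summation over the integers *)

Section zsum.
Context {R : realType}.
Implicit Types (h g u v : int -> R).

(** The sites are enumerated in the pairs Posz i, Negz i, so that the partial
    sums run over the symmetric windows [-k, k). *)
Definition zpair h : R^nat := fun i => h (Posz i) + h (Negz i).

Definition zsum h : R := limn (series (zpair h)).

Definition abs_summable h : Prop :=
  cvgn (series (zpair (fun n => `|h n|))).

Lemma abs_summable_le g h : (forall n, `|h n| <= g n) ->
  cvgn (series (zpair g)) -> abs_summable h.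
Proof.
move=> hg; apply: series_le_cvg => i; rewrite /zpair ?addr_ge0//.
- exact: le_trans (hg _).
- exact: le_trans (hg _).
- exact: lerD.
Qed.

Lemma abs_summable_cvg h : abs_summable h -> cvgn (series (zpair h)).
Proof.
move=> ch; apply: normed_cvg; move: ch; apply: series_le_cvg => i //.
- exact: normr_ge0.
- by rewrite addr_ge0.
- exact: ler_normD.
Qed.

Lemma abs_summableD h g : abs_summable h -> abs_summable g ->
  abs_summable (fun n => h n + g n).
Proof.
move=> ch cg; apply: (@abs_summable_le (fun n => `|h n| + `|g n|)).
  by move=> n; exact: ler_normD.
rewrite (_ : zpair _ = zpair (fun n => `|h n|) + zpair (fun n => `|g n|)).
  exact: is_cvg_seriesD.
by apply/funext => i; rewrite /zpair !fctE addrACA.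
Qed.

Lemma abs_summableZ a h : abs_summable h -> abs_summable (fun n => a * h n).
Proof.
move=> ch; apply: (@abs_summable_le (fun n => `|a| * `|h n|)).
  by move=> n; rewrite normrM.
rewrite (_ : zpair _ = `|a| *: zpair (fun n => `|h n|)).
  exact: is_cvg_seriesZ.
by apply/funext => i; rewrite /zpair !fctE /= /GRing.scale/= mulrDr.
Qed.

Lemma zsumD h g : abs_summable h -> abs_summable g ->
  zsum (fun n => h n + g n) = zsum h + zsum g.
Proof.
move=> ch cg; rewrite /zsum -lim_seriesD; [|exact: abs_summable_cvg..].
by congr (limn (series _)); apply/funext => i; rewrite /zpair !fctE addrACA.
Qed.

Lemma zsumZ a h : abs_summable h -> zsum (fun n => a * h n) = a * zsum h.
Proof.
move=> ch; transitivity (limn (series (a *: zpair h))); last first.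
  exact: (lim_seriesZ a (abs_summable_cvg ch)).
congr (limn (series _)); apply/funext => i.
by rewrite /zpair !fctE /= /GRing.scale/= mulrDr.
Qed.

Lemma ler_zsum h g : abs_summable h -> abs_summable g ->
  (forall n, h n <= g n) -> zsum h <= zsum g.
Proof.
move=> ch cg hg; apply: lim_series_le; [exact: abs_summable_cvg..|].
by move=> i; exact: lerD.
Qed.

Lemma zsum0 : zsum (fun=> 0) = 0.
Proof.
rewrite /zsum (_ : series _ = cst 0) ?lim_cst//.
apply/funext => k; rewrite /series /= big1// => i _.
by rewrite /zpair addr0.
Qed.

Lemma zsum_ge0 h : (forall n, 0 <= h n) -> abs_summable h -> 0 <= zsum h.
Proof.
move=> h0 ch; rewrite -zsum0; apply: ler_zsum => //.
by apply: (abs_summable_le _ ch) => n; rewrite normr0.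
Qed.

Lemma series_shift h k : series (zpair (fun n => h (n + 1))) k =
  series (zpair h) k + h k%:Z - h (- k%:Z).
Proof.
elim: k => [|k IH]; first by rewrite /series/= !big_geq// oppr0 add0r subrr.
rewrite !seriesSr IH /zpair NegzE.
rewrite (_ : (- k.+1%:Z + 1 : int) = - k%:Z); last by lia.
rewrite (_ : (k%:Z + 1 : int) = k.+1%:Z); last by lia.
by ring.
Qed.

(** The partial sums over the symmetric windows change only at the two ends
    when the summand is translated. *)
Lemma zsum_shift h : abs_summable h -> zsum (fun n => h (n + 1)) = zsum h.
Proof.
move=> ch; have cvh := abs_summable_cvg ch.
have h0 : zpair (fun n => `|h n|) @ \oo --> (0 : R).
  exact: (cvg_series_cvg_0 ch).
have hp : (fun k : nat => h k%:Z) @ \oo --> (0 : R).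
  apply/norm_cvg0P; apply: (squeeze_cvgr _ (cvg_cst 0) h0).
  by apply: nearW => k; rewrite normr_ge0 /zpair lerDl normr_ge0.
have hn : (fun k : nat => h (- k%:Z)) @ \oo --> (0 : R).
  rewrite -cvg_shiftS; apply/norm_cvg0P.
  apply: (squeeze_cvgr _ (cvg_cst 0) h0).
  apply: nearW => k; rewrite normr_ge0 /zpair.
  by rewrite NegzE lerDr normr_ge0.
rewrite /zsum (_ : series _ = series (zpair h) +
  (fun k : nat => h k%:Z) - (fun k : nat => h (- k%:Z))).
  apply/cvg_lim => //.
  rewrite -[X in _ --> X]addr0 -[X in _ --> X]subr0.
  by apply: cvgB => //; apply: cvgD.
by apply/funext => k; exact: series_shift.
Qed.

Lemma cvg_series_supp n h : (forall m, m != n -> h m = 0) ->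
  series (zpair h) @ \oo --> h n.
Proof.
move=> hn.
pose j := match n with Posz i => i | Negz i => i end.
apply: cvg_near_cst; near=> k.
have jk : (j < k)%N by near: k; exact: nbhs_infty_gt.
rewrite /series /= big_mkord (bigD1 (Ordinal jk))//= big1 ?addr0.
  rewrite /zpair /j; case: (n) hn => i hi /=.
    by rewrite (hi (Negz i))// addr0.
  by rewrite (hi (Posz i))// add0r.
move=> i; rewrite -val_eqE /= => ij; rewrite /zpair !hn ?addr0//.
  by apply: contra_neq ij; rewrite /j => <-.
by apply: contra_neq ij; rewrite /j => <-.
Unshelve. all: by end_near. Qed.

Lemma zsum_supp n h : (forall m, m != n -> h m = 0) -> zsum h = h n.
Proof. by move=> hn; apply/cvg_lim => //; exact: cvg_series_supp. Qed.

Lemma abs_summable_supp n h : (forall m, m != n -> h m = 0) -> abs_summable h.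
Proof.
move=> hn; apply: cvgP `|h n| _.
by apply: (@cvg_series_supp n (fun m => `|h m|)) => m /hn ->; rewrite normr0.
Qed.

Lemma abs_summable_shift h : abs_summable h -> abs_summable (fun n => h (n + 1)).
Proof.
rewrite /abs_summable => /cvg_seq_bounded/bounded_fun_has_ubound[M hM].
have leM k : series (zpair (fun n => `|h n|)) k <= M by apply: hM; exists k.
apply: nondecreasing_is_cvgn.
  by apply: nondecreasing_series => i _ _; rewrite addr_ge0.
exists (M + M) => _ [k _ <-].
rewrite (series_shift (fun n => `|h n|)).
have := leM k.+1; rewrite seriesSr /zpair.
have : 0 <= series (zpair (fun n => `|h n|)) k.
  by apply: sumr_ge0 => i _; rewrite addr_ge0.
have := normr_ge0 (h (- k%:Z)); have := normr_ge0 (h (Negz k)).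
have := leM k; lra.
Qed.

End zsum.

(** * The real Hilbert space of square-summable sequences *)

Section ell2.
Context (R : realType).

Definition sq_summable (u : int -> R) : Prop :=
  cvgn (series (zpair (fun n => u n ^+ 2))).

Lemma sq_summableM (u v : int -> R) : sq_summable u -> sq_summable v ->
  abs_summable (fun n => u n * v n).
Proof.
move=> cu cv; apply: (@abs_summable_le _ (fun n => u n ^+ 2 + v n ^+ 2)).
  move=> n; rewrite ler_norml; apply/andP; split.
    by have := sqr_ge0 (u n + v n); have := sqr_ge0 (u n); have := sqr_ge0 (v n); nra.
  by have := sqr_ge0 (u n - v n); have := sqr_ge0 (u n); have := sqr_ge0 (v n); nra.
rewrite (_ : zpair _ = zpair (fun n => u n ^+ 2) + zpair (fun n => v n ^+ 2)).
  exact: is_cvg_seriesD.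
by apply/funext => i; rewrite /zpair !fctE addrACA.
Qed.

Lemma sq_summable_le (K : R) (u v : int -> R) : sq_summable v ->
  (forall n, `|u n| <= K * `|v n|) -> sq_summable u.
Proof.
move=> cv uv; apply: (series_le_cvg (v_ := K ^+ 2 *: zpair (fun n => v n ^+ 2))).
- by move=> n; rewrite addr_ge0 ?sqr_ge0.
- by move=> n; rewrite mulr_ge0 ?sqr_ge0// addr_ge0 ?sqr_ge0.
- have sq n : u n ^+ 2 <= K ^+ 2 * v n ^+ 2.
    rewrite -(real_normK (num_real (u n))) -(real_normK (num_real (v n))).
    by rewrite -exprMn lerXn2r ?nnegrE// (le_trans _ (uv n)).
  move=> i; rewrite fctE -[leRHS]/(K ^+ 2 * (v i%:Z ^+ 2 + v (Negz i) ^+ 2)).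
  by rewrite mulrDr lerD.
- exact: is_cvg_seriesZ.
Qed.

(** The target is the regular module R^o, which makes int -> R^o a module. *)
Definition ell2_pred : {pred (int -> R^o)} := [pred u | `[< sq_summable u >]].

Lemma ell2_submod_closed : submod_closed ell2_pred.
Proof.
split=> [|a u v /asboolP cu /asboolP cv]; apply/asboolP.
  rewrite /sq_summable (_ : zpair _ = fun=> 0).
    rewrite (_ : series _ = cst 0); first exact: is_cvg_cst.
    by apply/funext => k; rewrite /series /= big1.
  apply/funext => i; transitivity (0 ^+ 2 + 0 ^+ 2 : R) => //.
  by rewrite expr0n addr0.
have h : abs_summable (fun n => (a * u n + v n) ^+ 2).
  rewrite (_ : (fun _ => _) = fun n => (a ^+ 2 * (u n * u n) +
      ((2 * a) * (u n * v n) + v n * v n))); last by apply/funext => n; ring.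
  have cuu := abs_summableZ (a := a ^+ 2) (sq_summableM cu cu).
  have cuv := abs_summableZ (a := 2 * a) (sq_summableM cu cv).
  exact: (abs_summableD cuu (abs_summableD cuv (sq_summableM cv cv))).
exact: abs_summable_cvg h.
Qed.

HB.instance Definition _ :=
  GRing.isSubmodClosed.Build R (int -> R^o) ell2_pred ell2_submod_closed.

Record ell2 := Ell2 { ell2_val :> int -> R^o ; _ : ell2_val \in ell2_pred }.

HB.instance Definition _ := [isSub for ell2_val].
HB.instance Definition _ := gen_eqMixin ell2.
HB.instance Definition _ := [Choice of ell2 by <:].
HB.instance Definition _ := [SubChoice_isSubLmodule of ell2 by <:].

Implicit Types (u v w : ell2) (a b : R).

Lemma ell2P u : sq_summable u.
Proof. by case: u => u u2 /=; apply/asboolP. Qed.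

Lemma ell2_eqP u v : (forall n, u n = v n :> R) -> u = v.
Proof. by move=> uv; apply: val_inj; apply/funext. Qed.

Lemma ell2D u v n : (u + v) n = u n + v n :> R. Proof. by []. Qed.
Lemma ell2B u v n : (u - v) n = u n - v n :> R. Proof. by []. Qed.
Lemma ell2Z a u n : (a *: u) n = a * u n :> R. Proof. by []. Qed.
Lemma ell20 n : (0 : ell2) n = 0 :> R. Proof. by []. Qed.

Definition ip u v : R := zsum (fun n => u n * v n).

Lemma ip_summable u v : abs_summable (fun n => u n * v n).
Proof. by apply: sq_summableM; exact: ell2P. Qed.

Lemma ipC u v : ip u v = ip v u.
Proof. by congr zsum; apply/funext => n; rewrite mulrC. Qed.

Lemma ipDl u v w : ip (u + v) w = ip u w + ip v w.
Proof.
rewrite -zsumD; [|exact: ip_summable..].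
by congr zsum; apply/funext => n; rewrite ell2D mulrDl.
Qed.

Lemma ipZl a u v : ip (a *: u) v = a * ip u v.
Proof.
rewrite -zsumZ; last exact: ip_summable.
by congr zsum; apply/funext => n; rewrite ell2Z mulrA.
Qed.

Lemma ipDr u v w : ip w (u + v) = ip w u + ip w v.
Proof. by rewrite ipC ipDl !(ipC w). Qed.

Lemma ipZr a u v : ip v (a *: u) = a * ip v u.
Proof. by rewrite ipC ipZl (ipC v). Qed.

Lemma ipNl u v : ip (- u) v = - ip u v.
Proof. by rewrite -scaleN1r ipZl mulN1r. Qed.

Lemma ipNr u v : ip v (- u) = - ip v u.
Proof. by rewrite -scaleN1r ipZr mulN1r. Qed.

Lemma ip0l u : ip 0 u = 0.
Proof. by rewrite -(scale0r 0) ipZl mul0r. Qed.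

Lemma ip0r u : ip u 0 = 0.
Proof. by rewrite ipC ip0l. Qed.

Definition ipE := (ipDl, ipDr, ipNl, ipNr, ipZl, ipZr, ip0l, ip0r).

Definition nsq u : R := ip u u.

Lemma nsq_ge0 u : 0 <= nsq u.
Proof. by apply: zsum_ge0 => [n|]; [exact: sqr_ge0|exact: ip_summable]. Qed.

Lemma nsqE u : nsq u = zsum (fun n => u n ^+ 2).
Proof. by []. Qed.

Lemma coord_le u n : u n ^+ 2 <= nsq u.
Proof.
pose h m := if m == n then u n * u n else 0.
have hu m : 0 <= h m <= u m * u m.
  by rewrite /h; case: eqVneq => [->|_]; rewrite -expr2 ?lexx sqr_ge0.
have hn : zsum h = u n ^+ 2.
  by rewrite (@zsum_supp _ n) /h ?eqxx// => m /negPf ->.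
rewrite -hn; apply: ler_zsum; last by move=> m; have /andP[] := hu m.
  apply: (@abs_summable_le _ (fun m => u m ^+ 2)); last exact: ell2P.
  by move=> m; have /andP[h0 hle] := hu m; rewrite ger0_norm.
exact: ip_summable.
Qed.

Lemma nsq_eq0 u : nsq u = 0 -> u = 0.
Proof.
move=> u0; apply: ell2_eqP => n; apply/eqP; rewrite -sqrf_eq0 eq_le sqr_ge0 andbT.
by rewrite -u0 coord_le.
Qed.

Lemma nsqD u v : nsq (u + v) = nsq u + 2 * ip u v + nsq v.
Proof. by rewrite /nsq !ipE (ipC v u); ring. Qed.

Lemma nsqZ a u : nsq (a *: u) = a ^+ 2 * nsq u.
Proof. by rewrite /nsq !ipE; ring. Qed.

Lemma nsqN u : nsq (- u) = nsq u.
Proof. by rewrite /nsq !ipE opprK. Qed.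

Lemma nsqB u v : nsq (u - v) = nsq u - 2 * ip u v + nsq v.
Proof. by rewrite nsqD nsqN ipNr mulrN. Qed.

Lemma cauchy_schwarz u v : ip u v ^+ 2 <= nsq u * nsq v.
Proof.
have [v0|v0] := eqVneq (nsq v) 0.
  by rewrite (nsq_eq0 v0) ip0r expr0n /= mulr_ge0 ?nsq_ge0.
have vp : 0 < nsq v by rewrite lt_neqAle eq_sym v0 nsq_ge0.
have := nsq_ge0 (nsq v *: u - ip u v *: v).
rewrite nsqB !nsqZ !ipE => h.
rewrite -(ler_pM2l vp) -subr_ge0; apply: le_trans h _.
by rewrite le_eqVlt; apply/orP; left; apply/eqP; ring.
Qed.

Definition nrm u : R := Num.sqrt (nsq u).

Lemma nrm_ge0 u : 0 <= nrm u. Proof. exact: sqrtr_ge0. Qed.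

Lemma nrm_sq u : nrm u ^+ 2 = nsq u.
Proof. by rewrite sqr_sqrtr ?nsq_ge0. Qed.

Lemma ip_le_nrm u v : `|ip u v| <= nrm u * nrm v.
Proof.
rewrite -ler_sqr ?nnegrE ?mulr_ge0 ?nrm_ge0//.
by rewrite exprMn !nrm_sq real_normK ?num_real// cauchy_schwarz.
Qed.

Lemma nrmD u v : nrm (u + v) <= nrm u + nrm v.
Proof.
rewrite -ler_sqr ?nnegrE ?addr_ge0 ?nrm_ge0// sqrrD !nrm_sq nsqD.
have := ler_norm (ip u v); have := ip_le_nrm u v; rewrite mulr2n; lra.
Qed.

Lemma nrmN u : nrm (- u) = nrm u.
Proof. by rewrite /nrm nsqN. Qed.

Lemma nrmB u v : nrm (u - v) <= nrm u + nrm v.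
Proof. by rewrite -(nrmN v) nrmD. Qed.

Lemma nrmZ a u : nrm (a *: u) = `|a| * nrm u.
Proof. by rewrite /nrm nsqZ sqrtrM ?sqr_ge0// sqrtr_sqr. Qed.

Lemma nrm_eq0 u : nrm u = 0 -> u = 0.
Proof. by move=> u0; apply: nsq_eq0; rewrite -nrm_sq u0 expr0n. Qed.

Lemma coord_le_nrm u n : `|u n| <= nrm u.
Proof.
by rewrite -ler_sqr ?nnegrE ?nrm_ge0// real_normK ?num_real// nrm_sq coord_le.
Qed.

End ell2.

(** * Shifts, multiplication operators and completeness *)

Section operators.
Context {R : realType}.
Implicit Types (u v w : ell2 R) (V W : int -> R).

Lemma to_ell2_subproof (h : int -> R) :
  {u : ell2 R | sq_summable h -> forall n, u n = h n :> R}.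
Proof.
have [ch|] := pselect (sq_summable h); last by exists 0.
have hP : (h : int -> R^o) \in @ell2_pred R by apply/asboolP.
by exists (Ell2 hP).
Qed.

Definition to_ell2 h : ell2 R := sval (to_ell2_subproof h).

Lemma to_ell2E h n : sq_summable h -> to_ell2 h n = h n :> R.
Proof. by move=> ch; rewrite /to_ell2; case: to_ell2_subproof => u /= ->. Qed.

(** The reflection n |-> - n - 1 exchanges Posz i and Negz i, so it preserves
    all partial sums; conjugating by it turns forward shifts into backward ones. *)
Lemma abs_summable_reflect (h : int -> R) : abs_summable h ->
  abs_summable (fun n => h (- n - 1)).
Proof.
rewrite /abs_summable (_ : zpair (fun _ => `|h (_ - _)|) = zpair (fun n => `|h n|))//.
apply/funext => i; rewrite /zpair addrC NegzE.
by congr (`|h _| + `|h _|); lia.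
Qed.

Lemma sq_summableE (h : int -> R) :
  sq_summable h <-> abs_summable (fun n => h n ^+ 2).
Proof.
rewrite /sq_summable /abs_summable.
rewrite (_ : (fun _ => `|_|) = fun n => h n ^+ 2)//.
by apply/funext => n; rewrite ger0_norm ?sqr_ge0.
Qed.

Lemma sq_summable_succ (h : int -> R) : sq_summable h ->
  sq_summable (fun n => h (n + 1)).
Proof. by move=> /sq_summableE ch; apply/sq_summableE/(abs_summable_shift ch). Qed.

Lemma sq_summable_pred (h : int -> R) : sq_summable h ->
  sq_summable (fun n => h (n - 1)).
Proof.
move=> /sq_summableE/abs_summable_reflect/abs_summable_shift/abs_summable_reflect.
move=> ch; apply/sq_summableE; rewrite (_ : (fun _ => _) =
  fun n => h (- (- n - 1 + 1) - 1) ^+ 2)//.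
by apply/funext => n; congr (h _ ^+ 2); lia.
Qed.

Definition bounded_pot V := exists C : R, forall n, `|V n| <= C.

Lemma sq_summable_mul V (h : int -> R) : bounded_pot V -> sq_summable h ->
  sq_summable (fun n => V n * h n).
Proof.
move=> [C VC] ch; apply: (@sq_summable_le _ C _ h) => // n.
by rewrite normrM ler_wpM2r.
Qed.

(** The operators below are sealed by opaque keys: with transparent definitions,
    rewriting with the coordinate equation of one of them would try to unify it
    with all the others by unfolding. *)
Fact succ_key : unit. Proof. exact: tt. Qed.
Fact pred_key : unit. Proof. exact: tt. Qed.
Fact diag_key : unit. Proof. exact: tt. Qed.
Fact trunc_key : unit. Proof. exact: tt. Qed.

Definition succ_op : ell2 R -> ell2 R :=
  locked_with succ_key (fun u => to_ell2 (fun n => u (n + 1))).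
Definition pred_op : ell2 R -> ell2 R :=
  locked_with pred_key (fun u => to_ell2 (fun n => u (n - 1))).
Definition diag_op : (int -> R) -> ell2 R -> ell2 R :=
  locked_with diag_key (fun V u => to_ell2 (fun n => V n * u n)).

Lemma succ_opE u n : succ_op u n = u (n + 1) :> R.
Proof. by rewrite /succ_op unlock to_ell2E//; apply: sq_summable_succ; exact: ell2P. Qed.

Lemma pred_opE u n : pred_op u n = u (n - 1) :> R.
Proof. by rewrite /pred_op unlock to_ell2E//; apply: sq_summable_pred; exact: ell2P. Qed.

Lemma diag_opE V u n : bounded_pot V -> diag_op V u n = V n * u n :> R.
Proof. by move=> bV; rewrite /diag_op unlock to_ell2E//; apply: sq_summable_mul => //; exact: ell2P. Qed.

Lemma ip_succ_op u v : ip (succ_op u) v = ip u (pred_op v).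
Proof.
rewrite [RHS]/ip -(zsum_shift (@ip_summable _ u (pred_op v))).
by congr zsum; apply/funext => n; rewrite succ_opE pred_opE addrK.
Qed.

Lemma ip_pred_op u v : ip (pred_op u) v = ip u (succ_op v).
Proof. by rewrite ipC -ip_succ_op ipC. Qed.

Lemma ip_diag_op V u v : bounded_pot V -> ip (diag_op V u) v = ip u (diag_op V v).
Proof. by move=> bV; congr zsum; apply/funext => n; rewrite !diag_opE// mulrCA mulrA. Qed.

Lemma nsq_succ_op u : nsq (succ_op u) = nsq u.
Proof.
rewrite /nsq ip_succ_op; congr ip; apply: ell2_eqP => n.
by rewrite pred_opE succ_opE subrK.
Qed.

Lemma nsq_pred_op u : nsq (pred_op u) = nsq u.
Proof.
rewrite -nsq_succ_op; congr nsq; apply: ell2_eqP => n.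
by rewrite succ_opE pred_opE addrK.
Qed.

Lemma nrm_le_coord (C : R) u v : 0 <= C -> (forall n, `|u n| <= C * `|v n|) ->
  nrm u <= C * nrm v.
Proof.
move=> C0 uv; rewrite -ler_sqr ?nnegrE ?mulr_ge0 ?nrm_ge0//.
rewrite exprMn !nrm_sq [nsq v]nsqE -zsumZ; last exact: ip_summable.
apply: ler_zsum => [||n]; [|apply: abs_summableZ|]; try exact: ip_summable.
rewrite -!expr2 -(real_normK (num_real (u n))) -(real_normK (num_real (v n))).
by rewrite -exprMn ler_sqr ?nnegrE ?mulr_ge0.
Qed.

Lemma nrm_diag_op_le (C : R) V u : (forall n, `|V n| <= C) ->
  nrm (diag_op V u) <= C * nrm u.
Proof.
move=> VC; apply: nrm_le_coord; first exact: le_trans (VC 0).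
by move=> n; rewrite diag_opE ?normrM ?ler_wpM2r//; exists C.
Qed.

Lemma nrm_diag_op_ge (c : R) V u : 0 <= c -> bounded_pot V ->
  (forall n, c <= `|V n|) -> c * nrm u <= nrm (diag_op V u).
Proof.
move=> c0 bV cV; have [->|cn0] := eqVneq c 0; first by rewrite mul0r nrm_ge0.
have cp : 0 < c by rewrite lt_neqAle eq_sym cn0.
rewrite -ler_pdivlMl//; apply: nrm_le_coord; first by rewrite invr_ge0.
move=> n; rewrite ler_pdivlMl// diag_opE// normrM ler_wpM2r//.
Qed.

Lemma nsq_le (M : R) (N : nat) u :
  (forall k, (N <= k)%N -> series (zpair (fun n => u n ^+ 2)) k <= M) ->
  nsq u <= M.
Proof.
move=> uM; rewrite nsqE /zsum; apply: limr_le; first exact: ell2P.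
by exists N.
Qed.

Lemma series_le_nsq u k : series (zpair (fun n => u n ^+ 2)) k <= nsq u.
Proof.
rewrite nsqE /zsum; apply: nondecreasing_cvgn_le; last exact: ell2P.
by apply: nondecreasing_series => i _ _; rewrite addr_ge0 ?sqr_ge0.
Qed.

(** The rank of the pair of [zpair] that contains a site: zrank n < N says that
    n lies in the window [-N, N). *)
Definition zrank (n : int) : nat := match n with Posz i => i | Negz i => i end.

Definition trunc : nat -> ell2 R -> ell2 R := locked_with trunc_key
  (fun N u => to_ell2 (fun n => if (zrank n < N)%N then u n else 0)).

Lemma truncE N u n : trunc N u n = (if (zrank n < N)%N then u n else 0) :> R.
Proof.
rewrite /trunc unlock to_ell2E//; apply: (@sq_summable_le _ 1 _ u); first exact: ell2P.
by move=> m; rewrite mul1r; case: ifP => // _; rewrite normr0.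
Qed.

Lemma trunc_approx u (e : R) : 0 < e -> exists N, nrm (u - trunc N u) <= e.
Proof.
move=> e0; pose h n := u n ^+ 2.
have /cvgrPdist_le/(_ (e ^+ 2)) : series (zpair h) @ \oo --> nsq u by exact: ell2P.
case; first by rewrite exprn_gt0.
move=> N _ /(_ N (leqnn _)) hN; exists N.
rewrite -ler_sqr ?nnegrE ?nrm_ge0 ?(ltW e0)// nrm_sq.
apply: le_trans hN; rewrite (le_trans _ (ler_norm _))//.
apply: (@nsq_le _ N) => k Nk.
pose g n := if (zrank n < N)%N then 0 else h n.
have -> : (fun n => (u - trunc N u) n ^+ 2) = g.
  apply/funext => n; rewrite ell2B truncE /g.
  by case: ifP => _; rewrite ?subr0// subrr expr0n.
have -> : series (zpair g) k = series (zpair h) k - series (zpair h) N.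
  rewrite -(subnK Nk) !series_addn addrAC subrr add0r.
  have -> : series (zpair g) N = 0.
    rewrite /series /= big_nat big1// => i /andP[_ iN].
    by rewrite /zpair /g /= iN addr0.
  rewrite add0r; apply: eq_big_nat => i /andP[Ni _].
  by rewrite /zpair /g /= ltnNge Ni.
by rewrite lerD2r series_le_nsq.
Qed.

(** On a fixed vector only a finite window of the potential matters: this
    turns pointwise closeness of potentials into strong closeness of operators. *)
Lemma diag_op_local u (C e : R) : 0 < e -> exists N eta, 0 < eta /\
  forall W, (forall n, `|W n| <= C) ->
    (forall n, (zrank n < N)%N -> `|W n| <= eta) -> nrm (diag_op W u) <= e.
Proof.
move=> e0; have [C0|C0] := ltP C 0.
  by exists 0%N, 1; split=> // W /(_ 0)/(le_trans (normr_ge0 _)); rewrite leNgt C0.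
have [|N hN] := @trunc_approx u (e / 2 / (C + 1)).
  by rewrite !divr_gt0// ltr_wpDl.
exists N, (e / 2 / (nrm u + 1)); split.
  by rewrite !divr_gt0// ltr_wpDl ?nrm_ge0.
move=> W WC WN; have bW : bounded_pot W by exists C.
have -> : diag_op W u = diag_op W (trunc N u) + diag_op W (u - trunc N u).
  by apply: ell2_eqP => n; rewrite ell2D !diag_opE// ell2B; ring.
apply: (le_trans (nrmD _ _)); rewrite (splitr e) lerD//.
  apply: (@le_trans _ _ (e / 2 / (nrm u + 1) * nrm u)).
    apply: nrm_le_coord; first by rewrite !divr_ge0 ?addr_ge0 ?nrm_ge0// ltW.
    move=> n; rewrite diag_opE// truncE normrM; case: ifP => nN.
      by rewrite ler_wpM2r// WN.
    by rewrite normr0 mulr0 mulr_ge0// !divr_ge0 ?addr_ge0 ?nrm_ge0// ltW.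
  rewrite -mulrA ler_piMr ?divr_ge0 ?(ltW e0)//.
  by rewrite ler_pdivrMl ?ltr_wpDl ?nrm_ge0// mulr1 lerDl.
apply: (le_trans (nrm_diag_op_le _ WC)).
apply: (@le_trans _ _ (C * (e / 2 / (C + 1)))); first by rewrite ler_wpM2l.
rewrite mulrCA ler_piMr ?divr_ge0 ?(ltW e0)//.
by rewrite ler_pdivrMr ?ltr_wpDl// mul1r lerDl.
Qed.

(** The coordinatewise limit is a limit in norm, since the Cauchy bounds hold
    for all partial sums and pass to the limit there. *)
Lemma ell2_complete (x : nat -> ell2 R) :
  (forall e : R, 0 < e -> exists K, forall k l, (K <= k)%N -> (K <= l)%N ->
     nrm (x k - x l) <= e) ->
  exists y, forall e : R, 0 < e -> exists K, forall k, (K <= k)%N ->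
     nrm (x k - y) <= e.
Proof.
move=> xc.
have cvx n : cvgn (fun k => x k n : R).
  apply/cauchy_cvgP/cauchy_exP => e e0.
  have [K hK] := xc (e / 2) (divr_gt0 e0 (ltr0Sn _ _)).
  exists (x K n); exists K => // k /= Kk; rewrite /ball /=.
  apply: (@le_lt_trans _ _ (e / 2)); last by lra.
  by rewrite -ell2B (le_trans (coord_le_nrm _ _))// hK.
pose z n : R := limn (fun k => x k n : R).
have bound e K : 0 < e -> (forall k l, (K <= k)%N -> (K <= l)%N ->
     nrm (x k - x l) <= e) -> forall k j, (K <= k)%N ->
    series (zpair (fun n => (x k n - z n) ^+ 2)) j <= e ^+ 2.
  move=> e0 hK k j Kk.
  have cv : (fun l => series (zpair (fun n => (x k n - x l n) ^+ 2)) j) @ \oo -->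
      series (zpair (fun n => (x k n - z n) ^+ 2)) j.
    have cvn n : (fun l => (x k n - x l n) ^+ 2) @ \oo --> (x k n - z n) ^+ 2.
      have cd : (fun l => x k n - x l n) @ \oo --> (x k n - z n : R).
        by apply: cvgB; [exact: cvg_cst|exact: cvx].
      exact: (cvgM cd cd).
    elim: j => [|j IH].
      rewrite /series /= big_geq// (_ : (fun _ => _) = cst 0); first exact: cvg_cst.
      by apply/funext => l; rewrite big_geq.
    rewrite seriesSr (_ : (fun _ => _) = fun l =>
        series (zpair (fun n => (x k n - x l n) ^+ 2)) j +
        ((x k j - x l j) ^+ 2 + (x k (Negz j) - x l (Negz j)) ^+ 2)).
      by apply: cvgD => //; apply: cvgD; exact: cvn.
    by apply/funext => l; rewrite seriesSr.
  apply: (cvgr_to_le cv); exists K => // l /= Kl.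
  apply: (@le_trans _ _ (nsq (x k - x l))).
    exact: (series_le_nsq (x k - x l)).
  by rewrite -nrm_sq ler_sqr ?nnegrE ?nrm_ge0 ?hK// ltW.
have sqs k e K : 0 < e -> (K <= k)%N -> (forall k l, (K <= k)%N -> (K <= l)%N ->
     nrm (x k - x l) <= e) -> sq_summable (fun n => x k n - z n).
  move=> e0 Kk hK; apply: nondecreasing_is_cvgn.
    by apply: nondecreasing_series => i _ _; rewrite addr_ge0 ?sqr_ge0.
  by exists (e ^+ 2) => _ [j _ <-]; exact: bound hK _ _ Kk.
have [K1 hK1] := xc 1 ltr01.
have sK1 := sqs K1 1 K1 ltr01 (leqnn _) hK1.
pose y := x K1 - to_ell2 (fun n => x K1 n - z n).
have yE n : y n = z n by rewrite /y ell2B to_ell2E// subKr.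
exists y => e e0; have [K hK] := xc e e0; exists K => k Kk.
rewrite -ler_sqr ?nnegrE ?nrm_ge0 ?(ltW e0)// nrm_sq.
apply: (@nsq_le _ 0) => j _; apply: le_trans (bound _ _ e0 hK k j Kk).
rewrite le_eqVlt; apply/orP; left; apply/eqP; congr (series (zpair _) j).
by apply/funext => n; rewrite ell2B yE.
Qed.

Definition e_ (n : int) : ell2 R := to_ell2 (fun m => (m == n)%:R).

Lemma e_E n m : e_ n m = (m == n)%:R :> R.
Proof.
apply: to_ell2E; apply/sq_summableE/(@abs_summable_supp _ n) => k /negPf ->.
by rewrite expr0n.
Qed.

Lemma ip_e n u : ip (e_ n) u = u n.
Proof.
rewrite /ip (@zsum_supp _ n); first by rewrite e_E eqxx mul1r.
by move=> m /negPf mn; rewrite e_E mn mul0r.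
Qed.

Fact schro_key : unit. Proof. exact: tt. Qed.

Definition schro : (int -> R) -> ell2 R -> ell2 R := locked_with schro_key
  (fun V u => succ_op u + pred_op u + diag_op V u).

Lemma schro_def V u : schro V u = succ_op u + pred_op u + diag_op V u.
Proof. by rewrite /schro unlock. Qed.

Lemma schroE V u n : bounded_pot V ->
  schro V u n = u (n + 1) + u (n - 1) + V n * u n :> R.
Proof. by move=> bV; rewrite schro_def !ell2D succ_opE pred_opE diag_opE. Qed.

End operators.

(** * Gaps of bounded self-adjoint operators *)

Section selfadjoint.
Context {R : realType}.
Implicit Types (u v w : ell2 R) (A B P : ell2 R -> ell2 R) (c m r : R).

Definition bsa A : Prop := [/\ forall a u v, A (a *: u + v) = a *: A u + A v,
  forall u v, ip (A u) v = ip u (A v) &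
  exists M, forall u, nrm (A u) <= M * nrm u].

(** For a self-adjoint operator this says that (- c, c) is free of spectrum;
    see [gapped_surj] for the invertibility. *)
Definition gap A c : Prop := forall u, c * nrm u <= nrm (A u).

Definition gapped A : Prop := exists2 c, 0 < c & gap A c.

Definition shift_op A r u := A u - r *: u.

Lemma bsaD A u v : bsa A -> A (u + v) = A u + A v.
Proof. by case=> lA _ _; have := lA 1 u v; rewrite !scale1r. Qed.

Lemma bsa0 A : bsa A -> A 0 = 0.
Proof. by move=> bA; apply: (addrI (A 0)); rewrite -(bsaD _ _ bA) !addr0. Qed.

Lemma bsaZ A a u : bsa A -> A (a *: u) = a *: A u.
Proof. by move=> bA; case: (bA) => lA _ _; rewrite -[a *: u]addr0 lA (bsa0 bA) addr0. Qed.

Lemma bsaB A u v : bsa A -> A (u - v) = A u - A v.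
Proof. by move=> bA; rewrite (bsaD _ _ bA) -scaleN1r (bsaZ _ _ bA) scaleN1r. Qed.

Lemma bsa_sym A u v : bsa A -> ip (A u) v = ip u (A v).
Proof. by case. Qed.

Lemma bsa_bound A c : bsa A -> exists M, [/\ 0 < M, c <= M &
  forall u, nrm (A u) <= M * nrm u].
Proof.
case=> _ _ [M AM]; exists (`|M| + `|c| + 1); split.
- by rewrite ltr_wpDl ?addr_ge0.
- by rewrite (le_trans (ler_norm c))// -addrA addrCA lerDl addr_ge0.
- move=> u; apply: (le_trans (AM u)); rewrite ler_wpM2r ?nrm_ge0//.
  by rewrite (le_trans (ler_norm M))// -addrA lerDl addr_ge0.
Qed.

Lemma bsa_shift A r : bsa A -> bsa (shift_op A r).
Proof.
move=> bA; split.
- move=> a u v; rewrite /shift_op (bsaD _ _ bA) (bsaZ _ _ bA) !scalerDr scalerN !scalerA.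
  by rewrite (mulrC r) opprD addrACA.
- by move=> u v; rewrite /shift_op !ipE (bsa_sym _ _ bA).
- case: bA => _ _ [M AM]; exists (M + `|r|) => u.
  by rewrite (le_trans (nrmB _ _))// nrmZ mulrDl lerD2r.
Qed.

Lemma bsa_scale A a : bsa A -> bsa (fun u => a *: A u).
Proof.
move=> bA; split.
- by move=> b u v; rewrite (bsaD _ _ bA) (bsaZ _ _ bA) scalerDr !scalerA mulrC.
- by move=> u v; rewrite !ipE (bsa_sym _ _ bA).
- case: bA => _ _ [M AM]; exists (`|a| * M) => u.
  by rewrite nrmZ -mulrA ler_wpM2l.
Qed.

Lemma bsa_sqr A : bsa A -> bsa (fun u => A (A u)).
Proof.
move=> bA; split.
- by move=> b u v; rewrite !(bsaD _ _ bA) !(bsaZ _ _ bA).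
- by move=> u v; rewrite !(bsa_sym _ _ bA).
- have [M [M0 _ AM]] := bsa_bound 0 bA; exists (M * M) => u.
  by rewrite (le_trans (AM _))// -mulrA ler_pM2l.
Qed.

Lemma gap_inj A u v : bsa A -> gapped A -> A u = A v -> u = v.
Proof.
move=> bA [c c0 gA] Auv; apply/eqP; rewrite -subr_eq0; apply/eqP/nrm_eq0.
apply/eqP; rewrite eq_le nrm_ge0 andbT -(ler_pM2l c0) mulr0.
by rewrite (le_trans (gA _))// (bsaB _ _ bA) Auv subrr /nrm /nsq ip0l sqrtr0.
Qed.

(** Gradient descent for |A u - w|^2 with step M^-2: the residual
    r is replaced by (1 - M^-2 A^2) r, whose square norm is smaller by the
    factor 1 - c^2 / M^2. *)
Lemma gapped_surj A w : bsa A -> gapped A -> exists u, A u = w.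
Proof.
move=> bA [c c0 gA]; have [M [M0 cM AM]] := bsa_bound c bA.
pose x := fix x (k : nat) : ell2 R :=
  if k is k'.+1 then x k' + M ^- 2 *: A (w - A (x k')) else 0.
pose r k := w - A (x k).
pose q := 1 - c ^+ 2 / M ^+ 2.
have q1 : q < 1 by rewrite /q gtrBl divr_gt0// exprn_gt0.
have q0 : 0 <= q.
  by rewrite /q subr_ge0 ler_pdivrMr ?exprn_gt0// mul1r ler_sqr// nnegrE ltW.
have rS k : r k.+1 = r k - M ^- 2 *: A (A (r k)).
  by rewrite {1}/r /= (bsaD _ _ bA) (bsaZ _ _ bA) opprD addrA.
have contr k : nsq (r k) <= q ^+ k * nsq w.
  elim: k => [|k IH]; first by rewrite /r /= (bsa0 bA) subr0 mul1r.
  rewrite exprS -mulrA; apply: (@le_trans _ _ (q * nsq (r k))); last first.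
    by rewrite ler_wpM2l.
  rewrite rS nsqB ipZr nsqZ -(bsa_sym _ _ bA) -/(nsq (A (r k))).
  have h1 : c ^+ 2 * nsq (r k) <= nsq (A (r k)).
    by rewrite -!nrm_sq -exprMn ler_sqr ?nnegrE ?mulr_ge0 ?nrm_ge0// ltW.
  have h2 : nsq (A (A (r k))) <= M ^+ 2 * nsq (A (r k)).
    by rewrite -!nrm_sq -exprMn ler_sqr ?nnegrE ?mulr_ge0 ?nrm_ge0// ltW.
  have M2 : 0 < M ^- 2 by rewrite invr_gt0 exprn_gt0.
  have h3 : M ^- 2 ^+ 2 * nsq (A (A (r k))) <= M ^- 2 * nsq (A (r k)).
    rewrite expr2 -mulrA ler_pM2l// -(ler_pM2l (exprn_gt0 2 M0)) mulrA.
    by rewrite mulfV ?mul1r// expf_neq0// gt_eqF.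
  have h4 : M ^- 2 * (c ^+ 2 * nsq (r k)) <= M ^- 2 * nsq (A (r k)).
    by rewrite ler_pM2l.
  by rewrite /q; move: h3 h4; set a := M ^- 2; nra.
have rsmall e : 0 < e -> exists K, forall k, (K <= k)%N -> nrm (r k) <= e.
  move=> e0; have e1 : 0 < e ^+ 2 / (nsq w + 1).
    by rewrite divr_gt0 ?exprn_gt0// ltr_wpDl ?nsq_ge0.
  have : q ^+ n @[n --> \oo] --> (0 : R) by apply: cvg_expr; rewrite ger0_norm.
  move=> /cvgrPdist_le/(_ _ e1)[K _ hK]; exists K => k /hK.
  rewrite sub0r normrN ger0_norm ?exprn_ge0// => hq.
  rewrite -ler_sqr ?nnegrE ?nrm_ge0 ?(ltW e0)// nrm_sq (le_trans (contr k))//.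
  apply: (@le_trans _ _ (e ^+ 2 / (nsq w + 1) * nsq w)).
    by rewrite ler_wpM2r ?nsq_ge0.
  rewrite mulrAC ler_pdivrMr ?ltr_wpDl ?nsq_ge0// ler_pM2l ?exprn_gt0//.
  by rewrite lerDl.
have [e e0|y hy] := @ell2_complete R x.
  have [K hK] := rsmall (c * e / 2) (divr_gt0 (mulr_gt0 c0 e0) (ltr0Sn _ _)).
  exists K => k l Kk Kl; rewrite -(ler_pM2l c0) (le_trans (gA _))//.
  have -> : A (x k - x l) = r l - r k.
    by rewrite (bsaB _ _ bA) /r opprB [RHS]addrC addrA subrK.
  apply: (le_trans (nrmB _ _)); rewrite (splitr (c * e)).
  by apply: lerD; exact: hK.
exists y; apply/eqP; rewrite -subr_eq0; apply/eqP/nrm_eq0.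
apply/eqP; rewrite eq_le nrm_ge0 andbT; apply/ler_addgt0Pr => e e0; rewrite add0r.
have [K1 h1] := rsmall (e / 2) (divr_gt0 e0 (ltr0Sn _ _)).
have [K2 h2] := hy (e / 2 / M) (divr_gt0 (divr_gt0 e0 (ltr0Sn _ _)) M0).
pose k := maxn K1 K2.
have -> : A y - w = - (A (x k - y) + r k).
  by rewrite (bsaB _ _ bA) /r [A (x k) - _ + _]addrC addrA subrK opprB.
rewrite nrmN; apply: (le_trans (nrmD _ _)); rewrite (splitr e).
apply: lerD; last by apply: h1; exact: leq_maxl.
apply: (le_trans (AM _)); rewrite -ler_pdivlMl// mulrC.
by apply: h2; exact: leq_maxr.
Qed.

(** For P >= 0 bounded by C, completing the square in <P (u - P u / C), u - P u / C>
    gives |P u|^2 <= C <P u, u>. *)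
Lemma pos_gap P : bsa P -> (forall u, 0 <= ip (P u) u) -> gapped P ->
  exists2 c, 0 < c & forall u, c * nsq u <= ip (P u) u.
Proof.
move=> bP pP [c c0 gP]; have [C [C0 _ PC]] := bsa_bound 0 bP.
exists (c ^+ 2 / C) => [|u]; first by rewrite divr_gt0// exprn_gt0.
have h1 : c ^+ 2 * nsq u <= nsq (P u).
  by rewrite -!nrm_sq -exprMn ler_sqr ?nnegrE ?mulr_ge0 ?nrm_ge0// ltW.
have h2 : ip (P (P u)) (P u) <= C * nsq (P u).
  rewrite (le_trans (ler_norm _))// (le_trans (ip_le_nrm _ _))//.
  by rewrite -nrm_sq expr2 mulrA ler_wpM2r ?nrm_ge0.
have := pP (C *: u - P u).
rewrite (bsaB _ _ bP) (bsaZ _ _ bP) !ipE (bsa_sym (P u) u bP) -/(nsq (P u)) => h3.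
rewrite mulrAC ler_pdivrMr//; apply: (le_trans h1).
rewrite -(ler_pM2l C0); nra.
Qed.

(** The operator A^2 - m^2 = (A - m) (A + m) is gapped, so once it has a sign it
    is bounded away from 0 by [pos_gap]. *)
Lemma sqr_sub_gap A m (s : bool) : bsa A ->
  gapped (shift_op A m) -> gapped (shift_op A (- m)) ->
  (forall u, 0 <= (-1) ^+ s * (nsq (A u) - m ^+ 2 * nsq u)) ->
  exists2 c, 0 < c &
    forall u, c * nsq u <= (-1) ^+ s * (nsq (A u) - m ^+ 2 * nsq u).
Proof.
move=> bA [c1 c10 g1] [c2 c20 g2] pA.
pose P u := (-1) ^+ s *: shift_op (fun u => A (A u)) (m ^+ 2) u.
have PE u : ip (P u) u = (-1) ^+ s * (nsq (A u) - m ^+ 2 * nsq u).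
  by rewrite /P /shift_op !ipE (bsa_sym _ _ bA).
have [|||c c0 hc] := @pos_gap P; last by exists c => // u; rewrite -PE.
- exact/bsa_scale/bsa_shift/bsa_sqr.
- by move=> u; rewrite PE.
- exists (c1 * c2) => [|u]; first exact: mulr_gt0.
  rewrite nrmZ normrX normrN1 expr1n mul1r.
  have -> : shift_op (fun u => A (A u)) (m ^+ 2) u =
      shift_op A m (shift_op A (- m) u).
    rewrite /shift_op scaleNr opprK (bsaD _ _ bA) (bsaZ _ _ bA) scalerDr scalerA -expr2.
    by rewrite opprD addrA addrK.
  by rewrite -mulrA (le_trans _ (g1 _))// ler_pM2l.
Qed.

(** The largest m <= d with |A u| >= m |u| cannot be smaller than d: otherwise
    A - m and A + m are gapped, and [sqr_sub_gap] improves the bound. *)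
Lemma gap_of_spectral_gap A d : bsa A -> 0 <= d ->
  (forall r, `|r| <= d -> gapped (shift_op A r)) ->
  gap A d.
Proof.
move=> bA d0 gA.
pose S := [set m : R | 0 <= m <= d /\ forall u, m ^+ 2 * nsq u <= nsq (A u)].
have S0 : S 0 by split; rewrite ?lexx ?d0// => u; rewrite expr0n /= mul0r nsq_ge0.
have Sub : has_sup S by split; [exists 0|exists d => m [/andP[]]].
pose m := sup S.
have m0 : 0 <= m by apply: ub_le_sup => //; case: Sub.
have md : m <= d by apply: ge_sup; [exists 0|move=> x [/andP[]]].
have mA u : m * nrm u <= nrm (A u).
  have [u0|u0] := eqVneq (nrm u) 0; first by rewrite u0 mulr0 nrm_ge0.
  have up : 0 < nrm u by rewrite lt_neqAle eq_sym u0 nrm_ge0.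
  rewrite -ler_pdivlMr//; apply: ge_sup; first by exists 0.
  move=> x [/andP[x0 _] xA]; rewrite ler_pdivlMr//.
  by rewrite -ler_sqr ?nnegrE ?mulr_ge0 ?nrm_ge0// exprMn !nrm_sq.
have [||u|c c0 hc] := @sqr_sub_gap A m false bA.
- by apply: gA; rewrite ger0_norm.
- by apply: gA; rewrite normrN ger0_norm.
- rewrite expr0 mul1r subr_ge0 -!nrm_sq -exprMn ler_sqr ?nnegrE//.
    by rewrite mulr_ge0// nrm_ge0.
  exact: nrm_ge0.
have hcm u : (m ^+ 2 + c) * nsq u <= nsq (A u).
  by have := hc u; rewrite expr0 mul1r; lra.
have mlt : m < Num.sqrt (m ^+ 2 + c).
  by rewrite -{1}(ger0_norm m0) -sqrtr_sqr ltr_sqrt ?ltrDl// ltr_wpDl// sqr_ge0.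
have gm : gap A (Num.sqrt (m ^+ 2 + c)).
  move=> u; rewrite -ler_sqr ?nnegrE ?mulr_ge0 ?nrm_ge0 ?sqrtr_ge0//.
  by rewrite exprMn !nrm_sq sqr_sqrtr ?hcm// addr_ge0 ?sqr_ge0// ltW.
suff dm : d <= m by move=> u; rewrite (le_trans _ (mA u))// ler_wpM2r ?nrm_ge0.
rewrite leNgt; apply/negP => mltd.
pose m' := Num.min d (Num.sqrt (m ^+ 2 + c)).
have : S m'.
  have m'0 : 0 <= m' by rewrite le_min d0 sqrtr_ge0.
  split; first by rewrite m'0 ge_min lexx.
  move=> u; rewrite -!nrm_sq -exprMn ler_sqr ?nnegrE ?mulr_ge0 ?nrm_ge0//.
  apply: le_trans (gm u); rewrite ler_wpM2r ?nrm_ge0//.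
  by rewrite ge_min lexx orbT.
move=> Sm'; have : m' <= m by apply: ub_le_sup => //; case: Sub.
by rewrite leNgt lt_min mltd mlt.
Qed.

(** The same argument for the smallest m >= d with |A u| <= m |u|. *)
Lemma nrm_of_spectral_bound A d : bsa A -> 0 <= d ->
  (forall r, d < `|r| -> gapped (shift_op A r)) ->
  forall u, nrm (A u) <= d * nrm u.
Proof.
move=> bA d0 gA.
pose S := [set m : R | d <= m /\ forall u, nrm (A u) <= m * nrm u].
have [M [M0 dM AM]] := bsa_bound d bA.
have S0 : S !=set0 by exists M.
have Slb : has_lbound S by exists d => m [].
pose m := inf S.
have dm : d <= m by apply: lb_le_inf => // x [].
have m0 : 0 <= m := le_trans d0 dm.
have mA u : nrm (A u) <= m * nrm u.
  have [u0|u0] := eqVneq (nrm u) 0.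
    by rewrite (nrm_eq0 u0) (bsa0 bA) /nrm /nsq ip0l sqrtr0 mulr0.
  have up : 0 < nrm u by rewrite lt_neqAle eq_sym u0 nrm_ge0.
  rewrite -ler_pdivrMr//; apply: lb_le_inf => // x [_ xA].
  by rewrite ler_pdivrMr.
suff md : m <= d by move=> u; rewrite (le_trans (mA u))// ler_wpM2r ?nrm_ge0.
rewrite leNgt; apply/negP => dltm.
have [||u|c c0 hc] := @sqr_sub_gap A m true bA.
- by apply: gA; rewrite ger0_norm.
- by apply: gA; rewrite normrN ger0_norm.
- rewrite expr1 mulN1r opprB subr_ge0 -!nrm_sq -exprMn ler_sqr ?nnegrE//.
    exact: nrm_ge0.
  by rewrite mulr_ge0// nrm_ge0.
pose m' := Num.max d (Num.sqrt (m ^+ 2 - c)).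
have /(ge_inf Slb) : S m'.
  split; first by rewrite le_max lexx.
  move=> u; rewrite -ler_sqr ?nnegrE ?mulr_ge0 ?nrm_ge0 ?le_max ?d0//.
  rewrite exprMn !nrm_sq; apply: (@le_trans _ _ ((m ^+ 2 - c) * nsq u)).
    by have := hc u; rewrite expr1 mulN1r; lra.
  rewrite ler_wpM2r ?nsq_ge0//; have [h|h] := leP 0 (m ^+ 2 - c); last first.
    by rewrite (le_trans (ltW h))// sqr_ge0.
  rewrite -{1}(sqr_sqrtr h) ler_sqr ?nnegrE ?sqrtr_ge0 ?le_max ?d0//.
  by rewrite lexx orbT.
rewrite leNgt -/m gt_max dltm /= => /negP; apply.
rewrite -{2}(ger0_norm m0) -sqrtr_sqr.
have mp : 0 < m := le_lt_trans d0 dltm.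
by rewrite ltr_sqrt ?gtrDl ?oppr_lt0// exprn_gt0.
Qed.

End selfadjoint.

(** * Flip counts on the integers *)

Section filling.

Definition fill (w : int -> bool) (n : int) : int -> bool :=
  fun m => (m == n) || w m.

Definition interval (m : int) (k : nat) : seq int := [seq m + i%:Z | i <- iota 0 k].

Lemma mem_interval m k n : (n \in interval m k) = (m <= n < m + k%:Z).
Proof.
apply/mapP/idP => [[i ik]|/andP[mn nk]].
  by move: ik; rewrite mem_iota => /= ik ->; lia.
exists `|n - m|%N; last by lia.
by rewrite mem_iota /=; lia.
Qed.

Lemma interval_uniq m k : uniq (interval m k).
Proof. by rewrite map_inj_uniq ?iota_uniq// => i j; lia. Qed.

Lemma interval_cover (s : seq int) (K : nat) :
  exists m k, (K <= k)%N /\ {subset s <= interval m k}.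
Proof.
elim: s => [|n s [m [k [Kk sub]]]]; first by exists 0, K; split.
exists (m - `|n|%:Z - `|m|%:Z), (k + 2 * `|n| + 2 * `|m| + 1)%N; split; first by lia.
move=> i; rewrite inE => /orP[/eqP ->|/sub]; rewrite !mem_interval; lia.
Qed.

Variable d : (int -> bool) -> int -> bool.

(** The total of [d] along a filling of the sites of a list, the last one
    first; by the exchange property it depends only on the set of sites. *)
Fixpoint flips (s : seq int) : nat :=
  if s is n :: s' then (d (fun m => m \in s') n + flips s')%N else 0%N.

Hypothesis d_shift : forall w n, d w n = d (fun m => w (m + n)) 0.

Hypothesis d_exchange : forall w n m, n != m -> ~~ w n -> ~~ w m ->
  (d w n + d (fill w n) m = d w m + d (fill w m) n)%N.

Hypothesis d_local : forall w, ~~ w 0 -> exists N : nat, forall w',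
  (forall m, (zrank m < N)%N -> w' m = w m) -> d w' 0 = d w 0.

Lemma flips_rem s n : uniq s -> n \in s -> flips s = flips (n :: rem n s).
Proof.
elim: s => // m s IH /= /andP[ms us].
rewrite inE eq_sym; have [-> //|mn] := eqVneq m n; rewrite /= => ns.
rewrite IH//=.
have nr : n \notin rem n s by rewrite mem_rem_uniq// inE eqxx.
have mr : m \notin rem n s by rewrite mem_rem_uniq// inE negb_and ms orbT.
have -> : (fun k => k \in s) = fill (fun k => k \in rem n s) n.
  apply/funext => k; rewrite /fill mem_rem_uniq// inE.
  by have [->|] := eqVneq k n.
have -> : (fun k => k \in m :: rem n s) = fill (fun k => k \in rem n s) m.
  by apply/funext => k; rewrite inE.
rewrite !addnA; congr addn; rewrite addnC [RHS]addnC.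
by apply: d_exchange => //; rewrite eq_sym.
Qed.

Lemma flips_perm s s' : uniq s -> perm_eq s s' -> flips s = flips s'.
Proof.
elim: s' s => [|n s' IH] s us; first by move/perm_nilP ->.
move=> ss'; have us' : uniq (n :: s') by rewrite -(perm_uniq ss').
have ns : n \in s by rewrite (perm_mem ss') mem_head.
rewrite (flips_rem us ns) /=.
have rs : perm_eq (rem n s) s'.
  by rewrite -(perm_cons n) (perm_trans _ ss')// perm_sym perm_to_rem.
rewrite (IH _ (rem_uniq _ us) rs); congr (nat_of_bool (d _ _) + _)%N.
by apply/funext => k; rewrite (perm_mem rs).
Qed.

Lemma leq_flips s s' : uniq s -> uniq s' -> {subset s <= s'} ->
  (flips s <= flips s')%N.
Proof.
move=> us us' ss'; pose t := [seq n <- s' | n \notin s].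
rewrite (@flips_perm s' (t ++ s))//; last first.
  apply: uniq_perm => //.
    rewrite cat_uniq filter_uniq// us andbT.
    by apply/hasPn => n ns; rewrite mem_filter ns.
  move=> n; rewrite mem_cat mem_filter.
  by have [/ss' ->|] := boolP (n \in s); rewrite ?orbF ?orbT.
by elim: t => //= n t IH; rewrite (leq_trans IH)// leq_addl.
Qed.

Lemma flips_intervalS m k : flips (interval m k.+1) =
  (d (fun n => n \in interval (- k%:Z) k) 0 + flips (interval m k))%N.
Proof.
rewrite (@flips_perm _ (m + k%:Z :: interval m k)); first last.
- apply: uniq_perm; rewrite ?interval_uniq//=.
    by rewrite interval_uniq mem_interval; lia.
  by move=> n; rewrite mem_interval in_cons mem_interval; lia.
- exact: interval_uniq.
rewrite /= d_shift; congr (nat_of_bool (d _ _) + _)%N.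
by apply/funext => n; rewrite !mem_interval; lia.
Qed.

Lemma flips_interval m k : flips (interval m k) = flips (interval 0 k).
Proof. by elim: k => // k IH; rewrite !flips_intervalS IH. Qed.

(** Two copies of a long interval, far apart, produce twice as many flips as
    one; but they sit in one longer interval, which produces no more than one
    copy does. *)
Lemma flips_eq0 s n : ~~ d (fun m => m < 0) 0 -> n \notin s -> uniq s ->
  d (fun m => m \in s) n = false.
Proof.
move=> d0 ns us.
have [//|N hN] := d_local (w := fun m => m < 0).
have stable k : (N <= k)%N -> flips (interval 0 k) = flips (interval 0 N).
  elim: k => [|k IH]; first by rewrite leqn0 => /eqP ->.
  rewrite leq_eqVlt => /orP[/eqP ->//|Nk]; rewrite flips_intervalS IH//.
  rewrite hN ?(negbTE d0)// => m mN; rewrite mem_interval.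
  by move: mN Nk; case: m => i /=; lia.
have [G hG] : exists G : nat, forall j, (j < N)%N -> forall w',
    (forall m, (zrank m < G)%N -> w' m = (m \in interval (- j%:Z) j)) ->
    d w' 0 = d (fun m => m \in interval (- j%:Z) j) 0.
  elim: (N) => [|j [G hG]]; first by exists 0%N.
  have [|G' hG'] := d_local (w := fun m => m \in interval (- j%:Z) j).
    by rewrite mem_interval; lia.
  exists (maxn G G') => i; rewrite ltnS leq_eqVlt => /orP[/eqP ->|ij] w' hw.
    by apply: hG' => m mG; rewrite hw// leq_max mG orbT.
  by apply: hG => // m mG; rewrite hw// leq_max mG.
pose M := (N + G + 1)%N.
have two j : (j <= N)%N -> flips (interval M%:Z j ++ interval 0 N) =
    (flips (interval 0 j) + flips (interval 0 N))%N.
  elim: j => // j IH jN; rewrite flips_intervalS.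
  rewrite (@flips_perm _ (M%:Z + j%:Z :: interval M%:Z j ++ interval 0 N)).
  - rewrite /= IH 1?ltnW// addnA; congr (nat_of_bool _ + _ + _)%N.
    rewrite d_shift; apply: hG => // m mG.
    rewrite mem_cat !mem_interval; move: mG jN; rewrite /M.
    by case: m => i /=; lia.
  - rewrite cat_uniq !interval_uniq andbT; apply/hasPn => m /=.
    by rewrite !mem_interval /M; lia.
  - apply: uniq_perm.
    + rewrite cat_uniq !interval_uniq andbT; apply/hasPn => m /=.
      by rewrite !mem_interval /M; lia.
    + rewrite /= mem_cat cat_uniq !interval_uniq !mem_interval andbT.
      apply/andP; split; first by rewrite /M; lia.
      by apply/hasPn => m /=; rewrite !mem_interval /M; lia.
    + by move=> m; rewrite mem_cat !mem_interval in_cons mem_cat !mem_interval; lia.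
have C0 : flips (interval 0 N) = 0%N.
  have := two N (leqnn N).
  have : (flips (interval M%:Z N ++ interval 0 N) <= flips (interval 0 (M + N)))%N.
    apply: leq_flips; rewrite ?interval_uniq//.
      rewrite cat_uniq !interval_uniq andbT; apply/hasPn => m /=.
      by rewrite !mem_interval /M; lia.
    by move=> m; rewrite mem_cat !mem_interval /M; lia.
  rewrite stable; last by lia.
  by lia.
have [m [k [Nk sub]]] := interval_cover (n :: s) N.
have : (flips (n :: s) <= 0)%N.
  rewrite -C0 -(stable k Nk) -(flips_interval m) leq_flips ?interval_uniq//=.
  by rewrite ns.
by rewrite /=; case: (d _ n).
Qed.

End filling.

(** When an interval is filled site by site, by locality the flip count is
    eventually the one next to a filled half-line. If this is 0, long intervals
    have bounded totals and [flips_eq0] applies; if it is 1, [flips_eq0]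
    applies to the complementary count. *)
Lemma flip_count_constant (d : (int -> bool) -> int -> bool) :
  (forall w n, d w n = d (fun m => w (m + n)) 0) ->
  (forall w n m, n != m -> ~~ w n -> ~~ w m ->
    (d w n + d (fill w n) m = d w m + d (fill w m) n)%N) ->
  (forall w, ~~ w 0 -> exists N : nat, forall w',
    (forall m, (zrank m < N)%N -> w' m = w m) -> d w' 0 = d w 0) ->
  exists b, forall s n, n \notin s -> uniq s -> d (fun m => m \in s) n = b.
Proof.
move=> ds de dl; have [dt|df] := boolP (d (fun m => m < 0) 0); last first.
  by exists false => s n ns us; exact: flips_eq0.
exists true => s n ns us; apply: negbFE.
apply: (@flips_eq0 (fun w m => ~~ d w m)); rewrite ?dt//.
- by move=> w m; rewrite ds.
- by move=> w m m' mm wm wm'; have := de w m m' mm wm wm'; do 4!case: (d _ _).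
- by move=> w w0; have [N hN] := dl w w0; exists N => w' /hN ->.
Qed.

(** * Real Schrodinger operators and their Green functions *)

Section schrodinger.
Context {R : realType}.
Implicit Types (u v w : ell2 R) (V W : int -> R) (c t r : R).

Lemma bounded_potD V W : bounded_pot V -> bounded_pot W ->
  bounded_pot (fun n => V n + W n).
Proof.
move=> [C VC] [D WD]; exists (C + D) => n.
by rewrite (le_trans (ler_normD _ _))// lerD.
Qed.

Lemma bounded_pot_cst c : bounded_pot (fun=> c).
Proof. by exists `|c|. Qed.

Lemma schro_bsa V : bounded_pot V -> bsa (schro V).
Proof.
move=> bV; split.
- move=> a u v; apply: ell2_eqP => n.
  by rewrite ell2D ell2Z !schroE// !ell2D !ell2Z; ring.
- move=> u v; rewrite !schro_def !ipDl !ipDr ip_succ_op ip_pred_op ip_diag_op//.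
  by rewrite [X in X + _ = _]addrC.
- case: bV => C VC; exists (1 + 1 + C) => u.
  rewrite schro_def !mulrDl !mul1r; apply: (le_trans (nrmD _ _)).
  apply: lerD; last exact: nrm_diag_op_le.
  apply: (le_trans (nrmD _ _)).
  by rewrite /nrm nsq_succ_op nsq_pred_op.
Qed.

Lemma schro_add V W u : bounded_pot V -> bounded_pot W ->
  schro (fun n => V n + W n) u = schro V u + diag_op W u.
Proof.
move=> bV bW; apply: ell2_eqP => n; have bVW := bounded_potD bV bW.
by rewrite ell2D !schroE// diag_opE//; ring.
Qed.

Lemma schro_diff V W u : bounded_pot W -> bounded_pot (fun n => V n - W n) ->
  schro V u = schro W u + diag_op (fun n => V n - W n) u.
Proof.
move=> bW bD; rewrite -schro_add//; congr (schro _ _); apply/funext => n.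
by rewrite addrC subrK.
Qed.

Lemma schro_cst V r u : bounded_pot V ->
  schro (fun n => V n + r) u = schro V u + r *: u.
Proof.
move=> bV; apply: ell2_eqP => n; have bVr := bounded_potD bV (bounded_pot_cst r).
by rewrite ell2D ell2Z !schroE//; ring.
Qed.

Lemma shift_schro V r : bounded_pot V ->
  shift_op (schro V) r = schro (fun n => V n - r).
Proof.
by move=> bV; apply/funext => u; rewrite schro_cst// scaleNr.
Qed.

(** Pointwise convergence of uniformly bounded potentials gives strong
    convergence of the operators. *)
Lemma schro_local V u (C e : R) : 0 < e -> bounded_pot V ->
  exists N eta, 0 < eta /\ forall W, bounded_pot W ->
    (forall n, `|V n - W n| <= C) ->
    (forall n, (zrank n < N)%N -> `|V n - W n| <= eta) ->
    nrm (schro V u - schro W u) <= e.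
Proof.
move=> e0 bV; have [N [eta [eta0 hN]]] := diag_op_local u C e0.
exists N, eta; split=> // W bW WC WN.
have bD : bounded_pot (fun n => V n - W n) by exists C.
by rewrite (schro_diff _ bW bD) addrC addKr hN.
Qed.

Definition pot_limit (G : set (int -> R)) V := exists C, forall (N : nat) eta,
  0 < eta -> exists W, [/\ G W, bounded_pot W, forall n, `|V n - W n| <= C &
     forall n, (zrank n < N)%N -> `|V n - W n| <= eta].

Lemma gap_limit V c : bounded_pot V ->
  pot_limit [set W | gap (schro W) c] V -> gap (schro V) c.
Proof.
move=> bV [C VW] u; apply/ler_addgt0Pr => e e0.
have [N [eta [eta0 hN]]] := schro_local u C e0 bV.
have [W [gW bW WC WN]] := VW N eta eta0.
apply: (le_trans (gW u)); rewrite -[schro W u](subrK (schro V u)) addrC.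
by apply: (le_trans (nrmD _ _)); rewrite lerD2l -nrmN opprB hN.
Qed.

Lemma nrm_limit V c : bounded_pot V ->
  pot_limit [set W | forall u, nrm (schro W u) <= c * nrm u] V ->
  forall u, nrm (schro V u) <= c * nrm u.
Proof.
move=> bV [C VW] u; apply/ler_addgt0Pr => e e0.
have [N [eta [eta0 hN]]] := schro_local u C e0 bV.
have [W [gW bW WC WN]] := VW N eta eta0.
rewrite -[schro V u](subrK (schro W u)) addrC.
by apply: (le_trans (nrmD _ _)); apply: lerD; [exact: gW|exact: hN].
Qed.

Definition green V n : ell2 R := xget 0 [set g | schro V g = e_ n].

Lemma greenE V n : bounded_pot V -> gapped (schro V) ->
  schro V (green V n) = e_ n.
Proof.
move=> bV gV; have [g gE] := gapped_surj (e_ n) (schro_bsa bV) gV.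
exact: (xgetPex 0 (ex_intro _ g gE : [set g | schro V g = e_ n] !=set0)).
Qed.

Lemma green_unique V n g : bounded_pot V -> gapped (schro V) ->
  schro V g = e_ n -> g = green V n.
Proof.
by move=> bV gV gE; apply: (gap_inj (schro_bsa bV) gV); rewrite greenE.
Qed.

Lemma green_sym V n m : bounded_pot V -> gapped (schro V) ->
  green V n m = green V m n.
Proof.
move=> bV gV; rewrite -(ip_e m) -(ip_e n) -(greenE m bV gV) -(greenE n bV gV).
by rewrite (bsa_sym _ _ (schro_bsa bV)) ipC (greenE n bV gV).
Qed.

(** The difference of the two Green functions is the vector
    (schro W)^-1 (W - V) (schro V)^-1 e_n, up to sign; its last factor is fixed,
    and W - V is small on a fixed vector. *)
Lemma green_local V n (C c e : R) : 0 < e -> 0 < c -> bounded_pot V ->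
  gap (schro V) c ->
  exists N eta, 0 < eta /\ forall W, bounded_pot W -> gap (schro W) c ->
    (forall n, `|V n - W n| <= C) ->
    (forall n, (zrank n < N)%N -> `|V n - W n| <= eta) ->
    `|green V n n - green W n n| <= e.
Proof.
move=> e0 c0 bV gV; have gVd : gapped (schro V) by exists c.
have [N [eta [eta0 hN]]] := schro_local (green V n) C (mulr_gt0 c0 e0) bV.
exists N, eta; split=> // W bW gW WC WN.
have gWd : gapped (schro W) by exists c.
rewrite -ell2B (le_trans (coord_le_nrm _ _))// -(ler_pM2l c0).
rewrite (le_trans (gW _))// (bsaB _ _ (schro_bsa bW)) (greenE _ bW gWd).
by rewrite -(greenE n bV gVd) -nrmN opprB hN.
Qed.

Definition add_site V t n := fun m => V m + t * (m == n)%:R.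

Lemma bounded_site t n : bounded_pot (fun m => t * (m == n)%:R).
Proof.
exists `|t| => m; rewrite normrM ler_piMr//.
by case: (m == n); rewrite ?normr1 ?normr0.
Qed.

Lemma bounded_add_site V t n : bounded_pot V -> bounded_pot (add_site V t n).
Proof. by move=> bV; apply: bounded_potD => //; exact: bounded_site. Qed.

Lemma schro_add_site V t n u : bounded_pot V ->
  schro (add_site V t n) u = schro V u + (t * u n) *: e_ n.
Proof.
move=> bV; rewrite schro_add//; last exact: bounded_site.
congr (_ + _); apply: ell2_eqP => m.
rewrite diag_opE ?ell2Z ?e_E; last exact: bounded_site.
by have [->|] := eqVneq m n; rewrite ?mulr1// !mulr0 mul0r.
Qed.

(** The perturbation determinant of the rank-one change of the potential by t
    at the site n. *)
Definition alpha t V n : R := 1 + t * green V n n.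

(** Were alpha zero, (schro V)^-1 e_n would be in the kernel of the perturbed
    operator. *)
Lemma alpha_neq0 t V n : bounded_pot V -> gapped (schro V) ->
  gapped (schro (add_site V t n)) -> alpha t V n != 0.
Proof.
move=> bV gV gV'; apply/eqP => a0.
have : green V n = 0.
  have bV' := bounded_add_site t n bV.
  apply: (gap_inj (schro_bsa bV') gV'); rewrite (bsa0 (schro_bsa bV')).
  rewrite schro_add_site// greenE// -[e_ n in X in X + _]scale1r -scalerDl.
  by rewrite -/(alpha t V n) a0 scale0r.
move=> g0; have := greenE n bV gV; rewrite g0 (bsa0 (schro_bsa bV)).
move=> /(congr1 (fun u : ell2 R => u n : R)); rewrite e_E eqxx ell20 => /eqP.
by rewrite eq_sym oner_eq0.
Qed.

(** Both sides are the determinant of 1 + t G on the two sites n and m, by the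
    rank-one resolvent formula. *)
Lemma alpha_add_site t V n m : bounded_pot V -> gapped (schro V) ->
  gapped (schro (add_site V t n)) ->
  alpha t V n * alpha t (add_site V t n) m =
  alpha t V n * alpha t V m - (t * green V n m) ^+ 2.
Proof.
move=> bV gV gV'; have a0 := alpha_neq0 bV gV gV'.
have bV' := bounded_add_site t n bV.
pose k := t * green V m n / alpha t V n.
have -> : alpha t (add_site V t n) m = 1 + t * (green V m m - k * green V n m).
  rewrite {1}/alpha; suff <- : green V m - k *: green V n = green (add_site V t n) m.
    by rewrite ell2B ell2Z.
  apply: green_unique => //; rewrite schro_add_site// ell2B ell2Z.
  rewrite (bsaB _ _ (schro_bsa bV)) (bsaZ _ _ (schro_bsa bV)) !greenE//.
  rewrite -addrA [X in _ + X](_ : _ = 0) ?addr0// -scaleNr -scalerDl.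
  rewrite (_ : _ + _ = t * green V m n - k * alpha t V n).
    by rewrite /k divfK// subrr scale0r.
  by rewrite /alpha; ring.
rewrite {1}/k (green_sym n m bV gV) [alpha t V m]/alpha.
by rewrite /k; field.
Qed.

(** As the potential grows by t at the site n, one eigenvalue crosses 0 if this
    holds, and none otherwise. *)
Definition neg_flip t V n : bool := alpha t V n < 0.

(** Both orders of perturbing two sites have the same pair of sign counts:
    they are the numbers of negative eigenvalues of the symmetric matrix
    (a, g; g, b), computed from either of its diagonal entries. *)
Lemma neg_flip_exchange t V n m : bounded_pot V -> gapped (schro V) ->
  gapped (schro (add_site V t n)) -> gapped (schro (add_site V t m)) ->
  gapped (schro (add_site (add_site V t n) t m)) ->
  gapped (schro (add_site (add_site V t m) t n)) ->
  (neg_flip t V n + neg_flip t (add_site V t n) m =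
   neg_flip t V m + neg_flip t (add_site V t m) n)%N.
Proof.
move=> bV gV gn gm gnm gmn.
have an := alpha_neq0 bV gV gn; have am := alpha_neq0 bV gV gm.
have anm := alpha_neq0 (bounded_add_site t n bV) gn gnm.
have amn := alpha_neq0 (bounded_add_site t m bV) gm gmn.
have En := alpha_add_site m bV gV gn; have Em := alpha_add_site n bV gV gm.
have gs := green_sym n m bV gV.
rewrite -gs in Em; set g := t * green V n m in En Em.
move: an am anm amn En Em; rewrite /neg_flip.
set a := alpha t V n; set b := alpha t V m.
set a' := alpha t (add_site V t n) m; set b' := alpha t (add_site V t m) n.
have g2 := sqr_ge0 g.
rewrite !neq_lt => /orP[] ha /orP[] hb /orP[] ha' /orP[] hb' En Em;
  rewrite ?ha ?hb ?ha' ?hb' ?(lt_gtF ha) ?(lt_gtF hb) ?(lt_gtF ha') ?(lt_gtF hb')//;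
  exfalso; nra.
Qed.

(** The form <A (A + t) v, v>, for A = schro V. *)
Definition cross_form t V v : R := nsq (schro V v) + t * ip (schro V v) v.

(** Completing the square in the coordinate n of u = A v: in terms of u the form
    is <u, u> + t <u, A^-1 u>, and the Schur complement of its (n, n) entry alpha
    is the same form for the operator perturbed at n. *)
Lemma cross_form_site t V n v : bounded_pot V -> gapped (schro V) ->
  gapped (schro (add_site V t n)) ->
  exists k v', [/\ cross_form t V v =
      cross_form t (add_site V t n) v' + alpha t V n * k ^+ 2 &
    schro (add_site V t n) v' = schro V v - schro V v n *: e_ n].
Proof.
move=> bV gV gV'; have a0 := alpha_neq0 bV gV gV'.
have bV' := bounded_add_site t n bV.
set u := schro V v; set g := green V n.
have [k kE] : exists k : R, k * alpha t V n = u n + t * v n.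
  by exists ((u n + t * v n) / alpha t V n); rewrite divfK.
pose v' := v - k *: g.
have E : schro (add_site V t n) v' = u - u n *: e_ n.
  rewrite schro_add_site// (bsaB _ _ (schro_bsa bV)) (bsaZ _ _ (schro_bsa bV)).
  rewrite greenE// -/u ell2B ell2Z -addrA; congr (_ + _).
  rewrite -(scaleNr k (e_ n)) -(scaleNr _ (e_ n)) -scalerDl; congr (_ *: _).
  transitivity (t * v n - k * alpha t V n); first by rewrite /alpha -/g; ring.
  by rewrite kE opprD addrCA subrr addr0.
exists k, v'; split=> //.
have ug : ip u g = v n.
  by rewrite /u (bsa_sym _ _ (schro_bsa bV)) greenE// ipC ip_e.
have ue : ip u (e_ n) = u n by rewrite ipC ip_e.
have ee : ip (e_ n) (e_ n) = 1 :> R by rewrite ip_e e_E eqxx.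
rewrite /cross_form E -/u /nsq /v' !ipE !ip_e ue e_E eqxx ug -[true%:R]/(1 : R).
apply/eqP; rewrite -subr_eq0; apply/eqP.
transitivity (- (k + u n) * (k * alpha t V n - (u n + t * v n)) -
    u n * k * (1 + t * g n - alpha t V n)).
  by ring.
by rewrite kE subrr mulr0 add0r /alpha subrr mulr0 oppr0.
Qed.

End schrodinger.

(** * The sign of A (A + t) *)

(** A nonzero alpha keeps its sign under small perturbations of the potential in
    a large window. *)
Lemma neg_flip_local {R : realType} (t : R) (V : int -> R) n (C c : R) :
  0 < t -> 0 < c -> bounded_pot V -> gap (schro V) c -> alpha t V n != 0 ->
  exists N eta, 0 < eta /\ forall W, bounded_pot W -> gap (schro W) c ->
    (forall n, `|V n - W n| <= C) ->
    (forall n, (zrank n < N)%N -> `|V n - W n| <= eta) ->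
    neg_flip t W n = neg_flip t V n.
Proof.
move=> t0 c0 bV gV a0; pose e := `|alpha t V n| / 2 / t.
have e0 : 0 < e by rewrite !divr_gt0// normr_gt0.
have [N [eta [eta0 hN]]] := green_local n C e0 c0 bV gV.
exists N, eta; split=> // W bW gW WC WN; have := hN W bW gW WC WN.
have -> : green V n n - green W n n = (alpha t V n - alpha t W n) / t.
  by rewrite /alpha; field; rewrite gt_eqF.
rewrite normrM (gtr0_norm (x := t^-1)) ?invr_gt0// ler_pM2r ?invr_gt0//.
rewrite /neg_flip; move: a0 {hN e0 e}; set a := alpha t V n; set a' := alpha t W n.
rewrite ler_distl neq_lt => /orP[] a0 /andP[h1 h2].
  rewrite a0; apply/idP; move: h1 h2; rewrite (ltr0_norm a0); lra.
rewrite (lt_gtF a0); apply/negbTE; rewrite -leNgt.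
move: h1 h2; rewrite (gtr0_norm a0); lra.
Qed.

Definition window N : seq int := map Posz (iota 0 N) ++ map Negz (iota 0 N).

Lemma mem_window N n : (n \in window N) = (zrank n < N)%N.
Proof.
rewrite mem_cat; case: n => i /=.
  rewrite mem_map ?mem_iota; last by move=> ? ? [].
  by rewrite orbC (_ : _ \in _ = false)//; apply/negbTE/mapP => -[].
rewrite orbC mem_map ?mem_iota; last by move=> ? ? [].
by rewrite orbC (_ : _ \in _ = false)//; apply/negbTE/mapP => -[].
Qed.

Lemma window_uniq N : uniq (window N).
Proof.
rewrite cat_uniq !map_inj_uniq ?iota_uniq ?andbT /=; try by move=> ? ? [].
by apply/hasPn => _ /mapP[i _ ->]; apply/mapP => -[].
Qed.

(** The images of such v are the finitely supported vectors; these are dense,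
    and the inverse of schro V is bounded. *)
Lemma cross_form_dense {R : realType} (t c : R) V (b : bool) :
  0 < c -> 0 < t -> bounded_pot V -> gap (schro V) c ->
  (forall N v, (forall n, (N <= zrank n)%N -> schro V v n = 0) ->
    0 <= (-1) ^+ b * cross_form t V v) ->
  forall v, 0 <= (-1) ^+ b * cross_form t V v.
Proof.
move=> c0 t0 bV gV hN v; have bA := schro_bsa bV.
apply/ler_addgt0Pr => e e0; set u := schro V v.
pose K := 2 * nrm u + 1 + t * (nrm u / c + nrm v + c^-1).
have K0 : 0 < K.
  by rewrite /K ltr_wpDr ?ltr_wpDl// ?mulr_ge0 ?nrm_ge0 ?addr_ge0 ?invr_ge0
    ?mulr_ge0 ?nrm_ge0 ?invr_ge0// ltW.
pose eta := Num.min 1 (e / K).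
have eta0 : 0 < eta by rewrite lt_min ltr01 divr_gt0.
have eta1 : eta <= 1 by rewrite ge_min lexx.
have [N] := trunc_approx u eta0.
have [p pE] : exists p, p = u - trunc N u by exists (u - trunc N u).
rewrite -pE => hp.
have [w hw] := gapped_surj p bA (ex_intro2 _ _ c c0 gV).
have wp : nrm w <= eta / c.
  by rewrite ler_pdivlMr// mulrC (le_trans (gV w))// hw.
have uv' : schro V (v - w) = trunc N u.
  by rewrite (bsaB _ _ bA) hw pE -/u opprB addrC subrK.
have := hN N (v - w); rewrite uv' => H.
have {}H : 0 <= (-1) ^+ b * cross_form t V (v - w).
  by apply: H => n Nn; rewrite truncE ltnNge Nn.
pose D := 2 * ip u p - nsq p + t * (ip u w + ip p v - ip p w).
have -> : cross_form t V v = cross_form t V (v - w) + D.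
  rewrite /cross_form uv' -/u (_ : trunc N u = u - p); last by rewrite pE subKr.
  by rewrite nsqB !ipE /D; ring.
have De : `|D| <= e.
  have h1 := ip_le_nrm u p; have h2 := ip_le_nrm u w; have h3 := ip_le_nrm p v.
  have h4 := ip_le_nrm p w; have h5 := nrm_sq p.
  have nu := nrm_ge0 u; have nv := nrm_ge0 v; have np := nrm_ge0 p.
  have nw := nrm_ge0 w.
  have k1 : `|ip u p| <= nrm u * eta by rewrite (le_trans h1)// ler_wpM2l.
  have k2 : `|ip u w| <= nrm u / c * eta.
    by rewrite (le_trans h2)// mulrAC -mulrA ler_wpM2l.
  have k3 : `|ip p v| <= nrm v * eta.
    by rewrite (le_trans h3)// mulrC ler_wpM2l.
  have k4 : `|ip p w| <= c^-1 * eta.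
    rewrite (le_trans h4)// mulrC -[leRHS]mulr1 mulrC (mulrC c^-1) mulrC.
    by rewrite ler_pM// (le_trans hp).
  have k5 : nsq p <= eta.
    by rewrite -h5 expr2 (le_trans (ler_pM np np hp hp))// ler_piMr// ltW.
  have kX : `|ip u w + ip p v - ip p w| <= (nrm u / c + nrm v + c^-1) * eta.
    move: k2 k3 k4; rewrite !mulrDl !ler_norml => /andP[? ?] /andP[? ?] /andP[? ?].
    by apply/andP; split; lra.
  have ktX : `|t * (ip u w + ip p v - ip p w)| <=
      t * ((nrm u / c + nrm v + c^-1) * eta).
    by rewrite normrM (gtr0_norm t0) ler_wpM2l// ltW.
  have : `|D| <= K * eta.
    rewrite /K [leRHS]mulrDl [(_ + 1) * eta]mulrDl mul1r -(mulrA t) -(mulrA 2) /D.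
    move: k1 ktX (nsq_ge0 p); rewrite !ler_norml => /andP[? ?] /andP[? ?] ?.
    by apply/andP; split; lra.
  move/le_trans; apply; rewrite -ler_pdivlMl// mulrC.
  by rewrite ge_min lexx orbT.
have sD : `|(-1) ^+ b * D| <= e by rewrite normrM normrX normrN1 expr1n mul1r.
by move: sD; rewrite (mulrDr _ (cross_form _ _ _)) ler_norml => /andP[h _]; lra.
Qed.

(** With m the smaller of s and t - s, the form t (|(A + s) v|^2 - m^2 |v|^2) is a
    combination with nonnegative coefficients of <A (A + t) v, v> and of |A v|^2
    if s <= t - s, of |(A + t) v|^2 otherwise. *)
Lemma cross_form_ge0_gapped {R : realType} (t s : R) V : bounded_pot V ->
  (forall v, 0 <= cross_form t V v) -> 0 < s -> s < t ->
  gapped (schro (fun n => V n + s)).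
Proof.
move=> bV qV s0 st; have t0 : 0 < t := lt_trans s0 st.
exists (Num.min s (t - s)) => [|v]; first by rewrite lt_min s0 subr_gt0.
have m0 : 0 <= Num.min s (t - s) by rewrite le_min (ltW s0) subr_ge0 ltW.
rewrite -ler_sqr ?nnegrE ?mulr_ge0 ?nrm_ge0// exprMn !nrm_sq schro_cst//.
have q := qV v; rewrite /cross_form in q.
have q' := nsq_ge0 (schro V v + t *: v).
rewrite nsqD ipZr nsqZ in q'; rewrite nsqD ipZr nsqZ.
have n0 := nsq_ge0 v; have a0 := nsq_ge0 (schro V v).
move: q q' n0 a0; set a := nsq _; set i := ip _ _; set n := nsq v => q q' n0 a0.
have [h|h] := leP s (t - s).
  suff : 0 <= a + 2 * (s * i) by lra.
  rewrite -(pmulr_rge0 _ t0).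
  rewrite (_ : t * _ = (t - 2 * s) * a + 2 * s * (a + t * i)); last by ring.
  by rewrite addr_ge0 ?mulr_ge0//; lra.
suff : 0 <= a + 2 * (s * i) + (2 * s * t - t ^+ 2) * n by lra.
rewrite -(pmulr_rge0 _ t0).
rewrite (_ : t * _ = (2 * s - t) * (a + 2 * (t * i) + t ^+ 2 * n) +
  2 * (t - s) * (a + t * i)); last by ring.
by rewrite addr_ge0 ?mulr_ge0//; lra.
Qed.

Lemma cross_form_le0 {R : realType} (t : R) V v : 0 < t -> bounded_pot V ->
  cross_form t V v <= 0 ->
  ip (schro V v) v <= 0 /\ 0 <= ip (schro (fun n => V n + t) v) v.
Proof.
move=> t0 bV q; rewrite schro_cst// ipDl ipZl.
rewrite /cross_form in q; have a0 := nsq_ge0 (schro V v).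
have a1 := nsq_ge0 (schro V v + t *: v); rewrite nsqD ipZr nsqZ in a1.
rewrite -/(nsq v); split; first by rewrite -(pmulr_rle0 _ t0); lra.
by rewrite -(pmulr_rge0 _ t0); nra.
Qed.

Section dichotomy.
Context {R : realType} (X : topologicalType).
Variables (pot : X -> int -> R) (C c t : R) (x0 : X).
Hypothesis c_gt0 : 0 < c.
Hypothesis t_gt0 : 0 < t.
Hypothesis pot_bounded : forall x n, `|pot x n| <= C.
Hypothesis pot_continuous : forall n, continuous (fun x => pot x n).
Hypothesis pot_translate : forall x k, exists y, forall n, pot y n = pot x (n + k).
Hypothesis X_connected : connected [set: X].

Definition flip_pot x (w : int -> bool) : int -> R :=
  fun n => pot x n + t * (w n)%:R.

Hypothesis flip_gap : forall x w, gap (schro (flip_pot x w)) c.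

Let flip_gapped x w : gapped (schro (flip_pot x w)).
Proof. by exists c. Qed.

Let flip_bounded x w : bounded_pot (flip_pot x w).
Proof.
exists (C + t) => n; rewrite (le_trans (ler_normD _ _))// lerD//.
by case: (w n); rewrite ?mulr1 ?mulr0 ?normr0 ?(gtr0_norm t_gt0)// ltW.
Qed.

Lemma flip_pot_fill x w n : ~~ w n ->
  flip_pot x (fill w n) = add_site (flip_pot x w) t n.
Proof.
move=> wn; apply/funext => m; rewrite /flip_pot /add_site /fill.
by have [->|] := eqVneq m n; rewrite ?(negbTE wn) /= ?mulr0 ?addr0.
Qed.

Lemma flip_alpha_neq0 x w n : ~~ w n -> alpha t (flip_pot x w) n != 0.
Proof. by move=> wn; apply: alpha_neq0 => //; rewrite -flip_pot_fill. Qed.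

Lemma pot_window x N (eta : R) : 0 < eta ->
  \forall y \near x, forall n, (zrank n < N)%N -> `|pot x n - pot y n| <= eta.
Proof.
move=> eta0; have cont n : \forall y \near x, `|pot x n - pot y n| <= eta.
  by have /cvgrPdist_le/(_ eta eta0) := @pot_continuous n x.
elim: N => [|N IH]; first by apply: nearW => y n.
apply: filterS3 IH (cont N) (cont (Negz N)) => y h hp hn n.
rewrite ltnS leq_eqVlt => /orP[/eqP nN|/h//].
by case: n nN => i /= ->.
Qed.

(** The continuous function alpha of x does not vanish, so its sign is
    constant on the connected space X. *)
Lemma neg_flip_cst x y w n : ~~ w n ->
  neg_flip t (flip_pot x w) n = neg_flip t (flip_pot y w) n.
Proof.
move=> wn.
have loc z : \forall z' \near z,
    neg_flip t (flip_pot z' w) n = neg_flip t (flip_pot z w) n.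
  have [N [eta [eta0 hN]]] := neg_flip_local (C + C) t_gt0 c_gt0
    (flip_bounded z w) (flip_gap z w) (flip_alpha_neq0 z wn).
  near=> z'; have E m : flip_pot z w m - flip_pot z' w m = pot z m - pot z' m.
    by rewrite /flip_pot; ring.
  apply: hN => // m; rewrite E.
    by rewrite (le_trans (ler_normB _ _))// lerD.
  by move: m; near: z'; exact: pot_window.
pose B b := [set z | neg_flip t (flip_pot z w) n = b].
have oB b : open (B b).
  by rewrite openE => z Bz; apply: filterS (loc z) => z' /= E; rewrite /B /= E.
pose b := neg_flip t (flip_pot y w) n.
suff : B b = [set: X] by move=> /seteqP[_ /(_ x I)].
apply: X_connected; first by exists y.
  by exists (B b) => //; rewrite setTI.
exists (B b); rewrite ?setTI//.
rewrite (_ : B b = ~` (B (~~ b))); first exact: open_closedC.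
apply/seteqP; rewrite /B; split=> z /=; first by move=> ->; case: b.
by case: (neg_flip _ _ _); case: b.
Unshelve. all: by end_near. Qed.

Lemma ell2_translate (u : ell2 R) (k : int) :
  exists v : ell2 R, forall n, v n = u (n + k) :> R.
Proof.
elim: k => [|k [v hv]|k [v hv]]; first by exists u => n; rewrite addr0.
  by exists (succ_op v) => n; rewrite succ_opE hv -addrA.
exists (pred_op v) => n; rewrite pred_opE hv; congr (ell2_val u _); lia.
Qed.

(** Translating the sites replaces x by another point y of X, which does not
    affect the sign. *)
Lemma neg_flip_translate x w n : ~~ w n ->
  neg_flip t (flip_pot x w) n = neg_flip t (flip_pot x (fun m => w (m + n))) 0.
Proof.
move=> wn; have [y hy] := pot_translate x n.
rewrite (@neg_flip_cst x y (fun m => w (m + n))) ?add0r//.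
suff E : green (flip_pot x w) n n = green (flip_pot y (fun m => w (m + n))) 0 0.
  by rewrite /neg_flip /alpha E.
have [v hv] := ell2_translate (green (flip_pot x w) n) n.
rewrite -[X in ell2_val _ X = _]add0r -hv; congr (ell2_val _ 0).
apply: green_unique => //; apply: ell2_eqP => m.
rewrite schroE// !hv /flip_pot hy -/(flip_pot x w (m + n)).
rewrite (addrAC m 1) (addrAC m (-1)) -schroE// greenE// !e_E.
by congr (_%:R); lia.
Qed.

(** The signs at a reference point x0 form a flip count in the sense of
    [flip_count_constant]. *)
Lemma flip_sign : exists b, forall x s n, n \notin s -> uniq s ->
  neg_flip t (flip_pot x (fun m => m \in s)) n = b.
Proof.
pose d w n := ~~ w n && neg_flip t (flip_pot x0 w) n.
have [w n|w n m nm wn wm|w w0|b hb] := @flip_count_constant d.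
- rewrite /d add0r; have [//|wn] := boolP (w n).
  exact: neg_flip_translate.
- have fn : ~~ fill w n m by rewrite /fill negb_or eq_sym nm.
  have fm : ~~ fill w m n by rewrite /fill negb_or nm.
  rewrite /d wn wm fn fm /= !flip_pot_fill//.
  by apply: neg_flip_exchange; rewrite -?flip_pot_fill.
- have [N [eta [eta0 hN]]] := neg_flip_local t t_gt0 c_gt0
    (flip_bounded x0 w) (flip_gap x0 w) (flip_alpha_neq0 x0 w0).
  exists N.+1 => w' ww'; rewrite /d ww'// w0 /=; apply: hN => // m.
    rewrite /flip_pot opprD addrACA subrr add0r .
    by case: (w m); case: (w' m); rewrite ?mulr1 ?mulr0 ?subrr ?subr0 ?sub0r
      ?normrN ?normr0 ?(gtr0_norm t_gt0)// ltW.
  by move=> mN; rewrite /flip_pot ww' ?subrr ?normr0 ?(ltW eta0)//; exact: ltnW.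
exists b => x s n ns us; rewrite (@neg_flip_cst x x0)//.
by have := hb s n ns us; rewrite /d ns.
Qed.

(** Peeling off the sites of the support of A v one at a time, each square
    contributes with the common sign of the alphas. *)
Lemma cross_form_sign_supp b :
  (forall x s n, n \notin s -> uniq s ->
    neg_flip t (flip_pot x (fun m => m \in s)) n = b) ->
  forall x s' s v, uniq (s' ++ s) ->
    (forall n, n \notin s' -> schro (flip_pot x (fun m => m \in s)) v n = 0) ->
  0 <= (-1) ^+ b * cross_form t (flip_pot x (fun m => m \in s)) v.
Proof.
move=> hb x; elim=> [|n s' IH] s v us hv.
  have -> : cross_form t (flip_pot x (fun m => m \in s)) v = 0.
    have E : schro (flip_pot x (fun m => m \in s)) v = 0.
      by apply: ell2_eqP => n; rewrite hv.
    by rewrite /cross_form E /nsq !ip0l mulr0 addr0.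
  by rewrite mulr0.
have [ns' us'] : n \notin s' ++ s /\ uniq (s' ++ s) by move: us => /= /andP[].
have [ns1 ns2] : n \notin s' /\ n \notin s.
  by move: ns'; rewrite mem_cat negb_or => /andP[].
have u_s : uniq s by move: us'; rewrite cat_uniq => /and3P[].
have E : (fun m => m \in n :: s) = fill (fun m => m \in s) n.
  by apply/funext => m; rewrite in_cons.
have [|k [v' [-> hv']]] := @cross_form_site R t (flip_pot x (fun m => m \in s)) n v
   (flip_bounded _ _) (flip_gapped _ _).
  by rewrite -flip_pot_fill.
rewrite -flip_pot_fill// -E in hv' *; rewrite mulrDr addr_ge0//.
  apply: IH => [|m ms'].
    by rewrite -(cat1s n s) uniq_catCA /= ns'.
  rewrite hv' ell2B ell2Z e_E; have [->|mn] := eqVneq m n.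
    by rewrite mulr1 subrr.
  by rewrite hv ?mulr0 ?subr0// inE negb_or mn.
rewrite mulrA mulr_ge0 ?sqr_ge0//.
have := hb x s n ns2 u_s; rewrite /neg_flip; case: b {hb IH} => /=.
  by move=> /ltW; rewrite expr1 mulN1r oppr_ge0.
by move=> /negbT; rewrite -leNgt expr0 mul1r.
Qed.

(** Either A (A + t) >= 0 for all the operators A = schro (pot x), or
    A (A + t) <= 0 for all of them. *)
Lemma cross_form_sign : exists b : bool, forall x v,
  0 <= (-1) ^+ b * cross_form t (pot x) v.
Proof.
have [b hb] := flip_sign; exists b => x.
have E : pot x = flip_pot x (fun m => m \in [::]).
  by apply/funext => n; rewrite /flip_pot in_nil mulr0 addr0.
have bV : bounded_pot (pot x) by exists C.
apply: (cross_form_dense c_gt0 t_gt0 bV); first by rewrite E.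
move=> N v hv; rewrite E; apply: (@cross_form_sign_supp b hb x (window N) [::]).
  by rewrite cats0 window_uniq.
by move=> n; rewrite mem_window -leqNgt -E => /hv.
Qed.

End dichotomy.

(** * Complex spectra and real gaps *)

Lemma esum_zpair {R : realType} (h : int -> R) : (forall n, 0 <= h n) ->
  (\esum_(n in [set: int]) (h n)%:E = \sum_(i <oo) (zpair h i)%:E)%E.
Proof.
move=> h0; rewrite (esumID (range Posz)); last by move=> i _; rewrite lee_fin.
have -> : ([set: int] `&` ~` range Posz = range Negz)%classic.
  rewrite setTI; apply/seteqP; split=> [[i|i]//= H|_ [i _ <-]] /=.
  - by case: H; exists i.
  - by exists i.
  - by case.
rewrite setTI !esum_image; try by move=> i j _ _ [].
rewrite -!nneseries_esumT; try by move=> i; rewrite lee_fin.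
rewrite -nneseriesD; try by move=> i _ _; rewrite lee_fin.
by [].
Qed.

Section bridge.
Context {R : realType}.
Implicit Types (u v : ell2 R) (V : int -> R) (psi : int -> R[i]).

Definition cplx (u v : int -> R) : int -> R[i] := fun n => (u n +i* v n)%C.

Lemma normc_sq (a b : R) : normc (a +i* b)%C ^+ 2 = a ^+ 2 + b ^+ 2.
Proof. by rewrite /normc sqr_sqrtr// addr_ge0 ?sqr_ge0. Qed.

Lemma sum_sq_cplx u v : sum_sq (cplx u v) = (nsq u + nsq v)%:E.
Proof.
rewrite /sum_sq; under eq_esum do rewrite normc_sq.
rewrite esum_zpair; last by move=> n; rewrite addr_ge0 ?sqr_ge0.
have cu := ip_summable (u := u) (v := u); have cv := ip_summable (u := v) (v := v).
rewrite /nsq /ip -zsumD// /zsum -EFin_lim; last first.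
  exact/abs_summable_cvg/abs_summableD.
congr (limn _); apply/funext => k; rewrite /= /series /= -sumEFin.
by apply: eq_bigr => i _; rewrite /zpair !expr2.
Qed.

Lemma l2_cplx u v : l2 (cplx u v).
Proof. by rewrite /l2 /= sum_sq_cplx ltry. Qed.

Lemma l2norm_cplx u v : l2norm (cplx u v) = Num.sqrt (nsq u + nsq v).
Proof. by rewrite /l2norm sum_sq_cplx. Qed.

Lemma l2_cplxP psi : l2 psi -> exists u v : ell2 R, psi = cplx u v.
Proof.
pose h n := complex.Re (psi n) ^+ 2 + complex.Im (psi n) ^+ 2.
have h0 n : 0 <= h n by rewrite addr_ge0 ?sqr_ge0.
have -> : l2 psi = (\sum_(i <oo) (zpair h i)%:E < +oo)%E.
  rewrite /l2 /= /sum_sq -esum_zpair//; congr (_ < _)%E; apply: eq_esum => n _.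
  by rewrite /h; case: (psi n) => a b; rewrite normc_sq.
move=> /nnseries_is_cvg ch.
have {}ch : cvgn (series (zpair h)) by apply: ch => i; rewrite addr_ge0.
have sq (g : int -> R) : (forall n, g n ^+ 2 <= h n) -> sq_summable g.
  move=> gh; apply/sq_summableE/(abs_summable_le _ ch) => n.
  by rewrite ger0_norm ?sqr_ge0.
exists (to_ell2 (fun n => complex.Re (psi n))), (to_ell2 (fun n => complex.Im (psi n))).
apply/funext => n; rewrite /cplx !to_ell2E; first by case: (psi n).
  by apply: sq => m; rewrite /h lerDr sqr_ge0.
by apply: sq => m; rewrite /h lerDl sqr_ge0.
Qed.

Lemma cplx_lin (a : R[i]) u v u' v' : a *: cplx u v + cplx u' v' =
  cplx (complex.Re a *: u - complex.Im a *: v + u')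
       (complex.Re a *: v + complex.Im a *: u + v').
Proof. by apply/funext => n; case: a. Qed.

Lemma schrodinger_cplx V (E : R) u v : bounded_pot V ->
  schrodinger V (cplx u v) - E%:C%C *: cplx u v =
  cplx (schro (fun n => V n - E) u) (schro (fun n => V n - E) v).
Proof.
move=> bV; have bVE := bounded_potD bV (bounded_pot_cst (- E)).
apply/funext => n; rewrite /cplx !schroE//.
transitivity (schrodinger V (cplx u v) n - E%:C%C * cplx u v n) => //.
rewrite /schrodinger /cplx; apply/eqP; rewrite eq_complex /= !mul0r !subr0 !addr0.
by apply/andP; split; apply/eqP; ring.
Qed.

Lemma resolvent_gapped V (E : R) : bounded_pot V ->
  resolvent_set (schrodinger V) E%:C%C -> gapped (schro (fun n => V n - E)).
Proof.
move=> bV [B [[_ _ [M BM]] hB]].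
exists (`|M| + 1)^-1 => [|u]; first by rewrite invr_gt0 ltr_wpDl.
rewrite ler_pdivrMl ?ltr_wpDl//.
have [+ _] := hB _ (l2_cplx u 0); rewrite schrodinger_cplx// => Bu.
have := BM _ (l2_cplx (schro (fun n => V n - E) u) (schro (fun n => V n - E) 0)).
rewrite Bu !l2norm_cplx (bsa0 (schro_bsa _)); last exact: bounded_potD bV (bounded_pot_cst _).
rewrite {2 4}/nsq ip0l !addr0 => /le_trans; apply.
by rewrite ler_wpM2r ?nrm_ge0// (le_trans (ler_norm M))// lerDl.
Qed.

(** The two real components are inverted separately. *)
Lemma gapped_resolvent V (E : R) : bounded_pot V ->
  gapped (schro (fun n => V n - E)) -> resolvent_set (schrodinger V) E%:C%C.
Proof.
move=> bV gA; set A := schro _ in gA.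
have bA : bsa A by exact/schro_bsa/(bounded_potD bV)/bounded_pot_cst.
have [I AI] : exists I, forall w, A (I w) = w.
  by have /choice[I hI] := fun w => gapped_surj w bA gA; exists I.
have IA u : I (A u) = u by apply: (gap_inj bA gA); rewrite AI.
have Ilin a u v : I (a *: u + v) = a *: I u + I v.
  by apply: (gap_inj bA gA); rewrite AI (bsaD _ _ bA) (bsaZ _ _ bA) !AI.
have ID u v : I (u + v) = I u + I v by rewrite -[u]scale1r Ilin !scale1r.
have I0 : I 0 = 0 by apply: (addrI (I 0)); rewrite -ID !addr0.
have IZ a u : I (a *: u) = a *: I u by rewrite -[_ *: u]addr0 Ilin I0 addr0.
have IN u : I (- u) = - I u by rewrite -scaleN1r IZ scaleN1r.
pose B psi := cplx (I (to_ell2 (fun n => complex.Re (psi n))))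
                   (I (to_ell2 (fun n => complex.Im (psi n)))).
have BE u v : B (cplx u v) = cplx (I u) (I v).
  by congr (cplx (I _) (I _)); apply: ell2_eqP => n; rewrite to_ell2E//=;
    exact: ell2P.
have [c c0 gc] := gA.
exists B; split; first split.
- by move=> _ /l2_cplxP[u [v ->]]; rewrite BE; exact: l2_cplx.
- move=> a _ _ /l2_cplxP[u [v ->]] /l2_cplxP[u' [v' ->]].
  by rewrite cplx_lin !BE cplx_lin !ID !IN !IZ.
- exists c^-1 => _ /l2_cplxP[u [v ->]]; rewrite BE !l2norm_cplx.
  have Ic w : nsq (I w) <= c ^- 2 * nsq w.
    rewrite ler_pdivlMl ?exprn_gt0// -!nrm_sq -exprMn.
    by rewrite ler_sqr ?nnegrE ?mulr_ge0 ?nrm_ge0 ?(ltW c0)// -[in leRHS](AI w).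
  rewrite -[c^-1]ger0_norm ?invr_ge0 ?(ltW c0)// -sqrtr_sqr -sqrtrM ?sqr_ge0//.
  by rewrite ler_wsqrtr// exprVn mulrDr lerD.
- move=> _ /l2_cplxP[u [v ->]]; rewrite schrodinger_cplx// !BE.
  by rewrite -/A !IA schrodinger_cplx// -/A !AI.
Qed.

Lemma spectrum_schrodinger V (E : R) (Sigma : set R) : bounded_pot V ->
  spectrum (schrodinger V) = [set x%:C%C | x in Sigma] ->
  gapped (schro (fun n => V n - E)) <-> ~ Sigma E.
Proof.
move=> bV sV; have sE : spectrum (schrodinger V) E%:C%C <-> Sigma E.
  by rewrite sV; split=> [[x Sx [<-]]//|SE]; exists E.
split=> [/gapped_resolvent gR /sE|nS]; first by apply; exact: gR.
by apply: resolvent_gapped => //; apply: contrapT => /sE.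
Qed.

End bridge.

(** * Compact sets of real numbers *)

Section compact_real.
Context {R : realType}.
Implicit Types (K : set R).

Lemma compact_minmax K : compact K -> K !=set0 ->
  exists p q, [/\ K p, K q & forall x, K x -> p <= x <= q].
Proof.
move=> cK K0; have cid : {within K, continuous (fun x : R => x)}.
  by apply: continuous_subspaceT => x; exact: cvg_id.
have [q qK hq] := compact_EVT_max K0 cK cid.
have [p pK hp] := compact_EVT_min K0 cK cid.
exists p, q; split; [exact: set_mem|exact: set_mem|].
by move=> x Kx; rewrite hp ?hq ?inE.
Qed.

Lemma compact_away K (E d : R) : compact K -> (forall x, K x -> d < `|x - E|) ->
  exists d', d < d' /\ forall x, K x -> d' <= `|x - E|.
Proof.
move=> cK Kd; have [K0|/set0P/negP] := pselect (K !=set0); last first.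
  by move=> /negPn/eqP ->; exists (d + 1); rewrite ltrDl.
have cf : {within K, continuous (fun x : R => `|x - E|)}.
  apply: continuous_subspaceT => x; apply: cvg_norm; apply: cvgB; first exact: cvg_id.
  exact: cvg_cst.
have [p /set_mem pK hp] := compact_EVT_min K0 cK cf.
by exists `|p - E|; split; [exact: Kd|move=> x Kx; rewrite hp ?inE].
Qed.

Lemma diamE K p q : K p -> K q -> (forall x, K x -> p <= x <= q) -> diam K = q - p.
Proof.
move=> Kp Kq pKq; have /andP[pq _] := pKq _ Kq.
have ub : ubound [set `|a - b| | a in K & b in K] (q - p).
  move=> _ [a /pKq/andP[? ?] [b /pKq/andP[? ?] <-]].
  by rewrite ler_norml; apply/andP; split; lra.
have qp : [set `|a - b| | a in K & b in K] (q - p).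
  by exists q => //; exists p => //; rewrite ger0_norm// subr_ge0.
apply/eqP; rewrite eq_le; apply/andP; split.
  by apply: ge_sup => //; exists (q - p).
by apply: ub_le_sup => //; exists (q - p).
Qed.

Lemma chE K p q : K p -> K q -> (forall x, K x -> p <= x <= q) ->
  ch K = [set x | p <= x <= q].
Proof.
move=> Kp Kq pKq; apply/seteqP; split.
  have seg (a x y : R) : 0 <= a -> a <= 1 -> p <= x <= q -> p <= y <= q ->
      p <= a * x + (1 - a) * y <= q.
    move=> a0 a1 /andP[px xq] /andP[py yq].
    have a1' : 0 <= 1 - a by rewrite subr_ge0.
    have := mulr_ge0 a0 (_ : 0 <= x - p); have := mulr_ge0 a0 (_ : 0 <= q - x).
    have := mulr_ge0 a1' (_ : 0 <= y - p); have := mulr_ge0 a1' (_ : 0 <= q - y).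
    rewrite !subr_ge0 => /(_ yq) ? /(_ py) ? /(_ xq) ? /(_ px) ?.
    by apply/andP; split; lra.
  apply: smallest_sub => // x y l; rewrite !inE /= => xpq ypq.
  exact: (seg l%:num).
move=> x /= /andP[px xq] M [cM KM].
have Mp := KM _ Kp; have Mq := KM _ Kq.
have [pq|pq] := eqVneq p q.
  by rewrite (_ : x = p)//; apply/eqP; rewrite eq_le px andbT pq xq.
have pltq : 0 < q - p by rewrite subr_gt0 lt_neqAle pq (le_trans px xq).
have l01 : (0 : R) <= (q - x) / (q - p) <= 1.
  rewrite divr_ge0 ?subr_ge0 ?(le_trans px xq)//= ler_pdivrMr// mul1r.
  by rewrite lerD2l lerN2.
have /andP[h0 h1] := l01.
have := cM p q (Itv01 h0 h1); rewrite !inE => /(_ Mp Mq).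
have E : x = (q - x) / (q - p) * p + (1 - (q - x) / (q - p)) * q.
  by field; rewrite gt_eqF.
by move=> H; rewrite E; exact: H.
Qed.

End compact_real.

(** * Spectra of limits and of connected families *)

Section spectral_limits.
Context {R : realType}.
Implicit Types (V W : int -> R) (Sigma : set R).

(** Only the real part of the spectrum is described: a real number outside
    Sigma is one at which the real operator is gapped. *)
Definition has_spectrum Sigma V := bounded_pot V /\
  forall e, gapped (schro (fun n => V n - e)) <-> ~ Sigma e.

Lemma has_spectrum_shift Sigma V E r : has_spectrum Sigma V -> ~ Sigma (E + r) ->
  gapped (shift_op (schro (fun n => V n - E)) r).
Proof.
move=> [bV sV] /sV; rewrite shift_schro; last first.
  exact: bounded_potD bV (bounded_pot_cst _).
by rewrite (_ : (fun n => _ - (E + r)) = fun n => V n - E - r)//;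
  apply/funext => n; rewrite opprD addrA.
Qed.

Lemma pot_limit_shift (G G' : set (int -> R)) V E :
  (forall W, G W -> G' (fun n => W n - E)) -> pot_limit G V ->
  pot_limit G' (fun n => V n - E).
Proof.
move=> GG' [C VG]; exists C => N eta eta0.
have [W [GW bW WC WN]] := VG N eta eta0.
have e n : V n - E - (W n - E) = V n - W n by rewrite opprB addrA subrK.
exists (fun n => W n - E); split; first exact: GG'.
- exact: bounded_potD bW (bounded_pot_cst _).
- by move=> n; rewrite e.
- by move=> n nN; rewrite e WN.
Qed.

Lemma gap_of_spectrum Sigma V (E d : R) : bounded_pot V -> 0 <= d ->
  pot_limit (has_spectrum Sigma) V -> (forall e, Sigma e -> d < `|e - E|) ->
  gap (schro (fun n => V n - E)) d.
Proof.
move=> bV d0 VS Sd; have bVE := bounded_potD bV (bounded_pot_cst (- E)).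
apply: (gap_limit bVE); apply: pot_limit_shift VS => W hW /=.
have [bW _] := hW; have bWE := bounded_potD bW (bounded_pot_cst (- E)).
apply: gap_of_spectral_gap (schro_bsa bWE) d0 _ => r rd.
apply: has_spectrum_shift hW _ => /Sd.
by rewrite addrAC subrr add0r ltNge rd.
Qed.

Lemma nrm_of_spectrum Sigma V (E d : R) : bounded_pot V -> 0 <= d ->
  pot_limit (has_spectrum Sigma) V -> (forall e, Sigma e -> `|e - E| <= d) ->
  forall u, nrm (schro (fun n => V n - E) u) <= d * nrm u.
Proof.
move=> bV d0 VS Sd; have bVE := bounded_potD bV (bounded_pot_cst (- E)).
apply: (nrm_limit bVE); apply: pot_limit_shift VS => W hW /=.
have [bW _] := hW; have bWE := bounded_potD bW (bounded_pot_cst (- E)).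
apply: nrm_of_spectral_bound (schro_bsa bWE) d0 _ => r dr.
apply: has_spectrum_shift hW _ => /Sd.
by rewrite addrAC subrr add0r leNgt dr.
Qed.

(** Otherwise the bounded operator schro V would dominate every multiple of
    the norm. *)
Lemma spectrum_neq0 Sigma V : has_spectrum Sigma V -> Sigma !=set0.
Proof.
move=> hV; have [bV _] := hV; apply: contrapT => /set0P/negP/negPn/eqP S0.
have [M [M0 _ VM]] := bsa_bound 0 (schro_bsa bV).
have VV : pot_limit (has_spectrum Sigma) V.
  exists 0 => N eta eta0; exists V; split=> // n; first by rewrite subrr normr0.
  by rewrite subrr normr0 ltW.
have /(_ (e_ 0)) := @gap_of_spectrum Sigma V 0 (M + 1) bV
  (addr_ge0 (ltW M0) ler01) VV (fun e => ltac:(by rewrite S0)).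
rewrite (_ : (fun n => V n - 0) = V); last by apply/funext => n; rewrite subr0.
move=> /le_trans/(_ (VM _)); rewrite /nrm /nsq ip_e e_E eqxx sqrtr1 !mulr1.
by rewrite leNgt ltrDl ltr01.
Qed.

Lemma gap_add_small V W (c h : R) : bounded_pot V -> gap (schro V) c ->
  (forall n, `|W n| <= h) -> gap (schro (fun n => V n + W n)) (c - h).
Proof.
move=> bV gV Wh u; have bW : bounded_pot W by exists h.
rewrite schro_add// mulrBl lerBlDr (le_trans (gV u))//.
rewrite -{1}[schro V u](addrK (diag_op W u)).
by apply: (le_trans (nrmB _ _)); rewrite lerD2l nrm_diag_op_le.
Qed.

Lemma gap_add_large V W (c h : R) : bounded_pot V -> bounded_pot W -> 0 <= c ->
  (forall u, nrm (schro V u) <= h * nrm u) -> (forall n, c <= `|W n|) ->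
  gap (schro (fun n => V n + W n)) (c - h).
Proof.
move=> bV bW c0 Vh cW u; rewrite schro_add// mulrBl lerBlDr.
apply: (le_trans (nrm_diag_op_ge u c0 bW cW)).
rewrite -{1}[diag_op W u](addKr (schro V u)) addrC.
by apply: (le_trans (nrmB _ _)); rewrite lerD2l.
Qed.

(** If A is gapped and r A >= 0 then |A v + r v| >= |A v|. *)
Lemma gapped_add_sign V (r : R) : bounded_pot V -> gapped (schro V) ->
  (forall v, 0 <= r * ip (schro V v) v) -> gapped (schro (fun n => V n + r)).
Proof.
move=> bV [c c0 gV] rV; exists c => // v; apply: le_trans (gV v) _.
rewrite -ler_sqr ?nnegrE ?nrm_ge0// !nrm_sq schro_cst// nsqD ipZr nsqZ.
have := rV v; have := mulr_ge0 (sqr_ge0 r) (nsq_ge0 v); lra.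
Qed.

(** Let A be the operator with potential V x0 + a - E and t = b - a. By
    [cross_form_sign] the operator A (A + t) has a sign: if it is nonnegative,
    (- t, 0) is a gap of A, and if it is nonpositive, A <= 0 <= A + t. So the
    spectrum of V x0 either avoids (E - b, E - a) or lies inside it. *)
Lemma spectrum_gap_dichotomy (X : topologicalType) (V : X -> int -> R) (x0 : X)
    Sigma (C c a b E : R) :
  connected [set: X] -> (forall x n, `|V x n| <= C) ->
  (forall n, continuous (fun x => V x n)) ->
  (forall x k, exists y, forall n, V y n = V x (n + k)) ->
  has_spectrum Sigma (V x0) -> a < b -> 0 < c ->
  (forall x (w : int -> bool),
    gap (schro (fun n => V x n + (if w n then b else a) - E)) c) ->
  forall e e', Sigma e -> E - b < e < E - a -> Sigma e' -> E - b < e' < E - a.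
Proof.
move=> Xc VC Vcont Vtr hS ab c0 gapV e e' Se /andP[e1 e2] Se'.
pose pot x n := V x n + a - E; pose t := b - a.
have t0 : 0 < t by rewrite subr_gt0.
have potb x n : `|pot x n| <= C + `|a| + `|E|.
  by rewrite (le_trans (ler_normB _ _))// lerD// (le_trans (ler_normD _ _))// lerD.
have bpot x : bounded_pot (pot x) by exists (C + `|a| + `|E|).
have potc n : continuous (fun x => pot x n).
  move=> x; apply: cvgB; last exact: cvg_cst.
  by apply: cvgD; [exact: Vcont|exact: cvg_cst].
have pott x k : exists y, forall n, pot y n = pot x (n + k).
  by have [y hy] := Vtr x k; exists y => n; rewrite /pot hy.
have flipE x w : flip_pot pot t x w = fun n => V x n + (if w n then b else a) - E.
  by apply/funext => n; rewrite /flip_pot /pot /t; case: (w n) => /=; ring.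
have fg x w : gap (schro (flip_pot pot t x w)) c by rewrite flipE.
have potE r : (fun n => V x0 n - (E - a - r)) = fun n => pot x0 n + r.
  by apply/funext => n; rewrite /pot; ring.
have [s hs] := cross_form_sign x0 c0 t0 potb potc pott Xc fg.
have [bV0 sV0] := hS.
case: s hs => hs; last first.
  have : gapped (schro (fun n => pot x0 n + (E - a - e))).
    apply: (cross_form_ge0_gapped (t := t)) => //; try by rewrite /t; lra.
    by move=> v; have := hs x0 v; rewrite expr0 mul1r.
  by rewrite -potE subKr => /sV0.
have sgn v : ip (schro (pot x0) v) v <= 0 /\
    0 <= ip (schro (fun n => pot x0 n + t) v) v.
  apply: cross_form_le0 => //.
  by rewrite -oppr_ge0 -mulN1r -[-1]expr1; exact: (hs x0 v).
have gw w W : (forall n, flip_pot pot t x0 w n = W n) -> gapped (schro W).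
  by move=> wW; exists c => //; rewrite (_ : W = flip_pot pot t x0 w)//; apply/funext.
have g0 : gapped (schro (pot x0)).
  by apply: (gw (fun=> false)) => n; rewrite /flip_pot mulr0 addr0.
have g1 : gapped (schro (fun n => pot x0 n + t)).
  by apply: (gw (fun=> true)) => n; rewrite /flip_pot mulr1.
apply/andP; split; rewrite ltNge; apply/negP => h.
  have bt := bounded_potD (bpot x0) (bounded_pot_cst t).
  have := gapped_add_sign (r := E - b - e') bt g1.
  have -> : (fun n => pot x0 n + t + (E - b - e')) = fun n => V x0 n - e'.
    by apply/funext => n; rewrite /pot /t; ring.
  by move=> H; case: (sV0 e') => + _; apply=> //; apply: H => v;
    rewrite mulr_ge0 ?subr_ge0//; have [] := sgn v.
have := gapped_add_sign (r := E - a - e') (bpot x0) g0.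
rewrite -potE subKr => H; case: (sV0 e') => + _; apply=> //; apply: H => v.
by rewrite mulr_le0 ?subr_le0//; have [] := sgn v.
Qed.

End spectral_limits.

Section orbits.
Context {X : Type} (T Tinv : X -> X).

Lemma iterz_succ n x : cancel Tinv T -> cancel T Tinv ->
  iterz T Tinv n (T x) = iterz T Tinv (n + 1) x.
Proof.
move=> TK TK'; case: n => n.
  by rewrite (_ : n%:Z + 1 = n.+1%:Z) /iterz ?iterSr//; lia.
case: n => [|n]; first by rewrite /= TK'.
rewrite (_ : Negz n.+1 + 1 = Negz n); last by lia.
by rewrite /iterz iterSr TK'.
Qed.

Lemma iterz_translate x k : cancel Tinv T -> cancel T Tinv ->
  exists y, forall n, iterz T Tinv n y = iterz T Tinv (n + k) x.
Proof.
move=> TK TK'; elim: k => [|k [y hy]|k [y hy]].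
- by exists x => n; rewrite addr0.
- by exists (T y) => n; rewrite iterz_succ// hy; congr (iterz _ _ _ x); lia.
- exists (Tinv y) => n.
  rewrite -[n in LHS](subrK 1) -iterz_succ// TK hy.
  by congr (iterz _ _ _ x); lia.
Qed.

End orbits.

Lemma iterz_continuous {X : topologicalType} (T Tinv : X -> X) n :
  homeomorphism T Tinv -> continuous (iterz T Tinv n).
Proof.
case=> _ _ cT cTi.
have it (g : X -> X) k : continuous g -> continuous (iter k g).
  move=> cg; elim: k => [|k IH] x; first exact: cvg_id.
  exact: cvg_comp (IH x) (cg _).
by case: n => k; exact: it.
Qed.

Section full_support.
Local Open Scope ereal_scope.

Lemma ae_meets d (Y : measurableType d) (R : realType)
    (P : {measure set Y -> \bar R}) (A Q : set Y) :
  measurable A -> 0 < P A -> {ae P, forall y, Q y} -> exists2 y, A y & Q y.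
Proof.
move=> mA PA [B [mB PB0 sub]]; apply: contrapT => nAQ.
have AB : A `<=` B.
  by move=> y Ay; apply: sub => Qy; apply: nAQ; exists y.
by move: PA; rewrite ltNge -PB0 le_measure ?inE.
Qed.

Lemma coord_cylinder_measurable (R : realType)
    (nu : probability (measurableTypeR R) R) (J : seq int)
    (A : int -> set (measurableTypeR R)) : (forall j, measurable (A j)) ->
  measurable ([set w | forall j, j \in J -> A j (\val (w j))] : set (Omega nu)).
Proof.
move=> mA; elim: J => [|j J IH].
  by rewrite (_ : [set _ | _] = setT)//; apply/seteqP; split.
rewrite (_ : [set _ | _] = [set w : Omega nu | A j (\val (w j))] `&`
    [set w : Omega nu | forall j, j \in J -> A j (\val (w j))]).
  apply: measurableI => //; apply: sub_gen_smallest.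
  by exists j, (A j).
apply/seteqP; split=> [w Aw|w [Aj AJ] i].
  split=> [|i iJ]; first by apply: Aw; rewrite mem_head.
  by apply: Aw; rewrite in_cons iJ orbT.
by rewrite in_cons => /orP[/eqP ->|/AJ].
Qed.

Lemma coord_cylinder_gt0 (R : realType)
    (nu : probability (measurableTypeR R) R) (nuZ : probability (Omega nu) R)
    (J : seq int) (A : int -> set (measurableTypeR R)) (w0 : seqspace nu) :
  is_product_measure nuZ -> uniq J -> (forall j, open (A j : set R)) ->
  (forall j, A j (\val (w0 j))) ->
  0 < nuZ [set w : seqspace nu | forall j, j \in J -> A j (\val (w j))].
Proof.
move=> nuZP uJ oA Aw0; rewrite nuZP//; last first.
  by move=> j; exact: measurable_realfun.open_measurable.
elim/big_ind: _ => [||j _]; [exact: lte01|exact: mule_gt0|].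
by have /set_mem := valP (w0 j); apply.
Qed.

Lemma borel_open_measurable (R : realType) (X : pmetricType R) (U : set X) :
  open U -> measurable (U : set (borel X)).
Proof. exact: sub_gen_smallest. Qed.

End full_support.

(** * The almost sure spectra *)

Lemma bigstarE {R : realType} (A S : set R) (p q a b : R) :
  A p -> A q -> (forall x, A x -> p <= x <= q) ->
  S a -> S b -> (forall x, S x -> a <= x <= b) ->
  bigstar A S = if b - a <= q - p then [set E | exists2 e, A e & a <= E - e <= b]
                else [set E | exists2 s, S s & p <= E - s <= q].
Proof.
move=> Ap Aq pAq Sa Sb aSb.
rewrite /bigstar (diamE Ap Aq pAq) (diamE Sa Sb aSb) (chE Ap Aq pAq) (chE Sa Sb aSb).
case: ifP => _; apply/seteqP; split=> E /=.
- by move=> [e Ae [s sab <-]]; exists e => //; rewrite addrAC subrr add0r.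
- by move=> [e Ae Ee]; exists e => //; exists (E - e) => //; rewrite addrC subrK.
- by move=> [e epq [s Ss <-]]; exists s => //; rewrite addrK.
- by move=> [s Ss Es]; exists (E - s) => //; exists s => //; rewrite subrK.
Qed.

Unset Implicit Arguments.

Theorem theorem1p1 (R : realType) (X : pmetricType R) (T Tinv : X -> X)
    (mu : probability (borel X) R) (f : X -> R)
    (nu : probability (measurableTypeR R) R)
    (nuZ : probability (Omega nu) R) (Sigma0 Sigma1 : set R)
    (X_compact : compact [set: X])
    (T_homeo : homeomorphism T Tinv)
    (mu_ergodic : ergodic mu T)
    (mu_support : msupport (X := X) mu = [set: X])
    (f_cont : continuous f)
    (nu_compact : compact (msupport nu))
    (nu_card : (`I_2 #<= msupport nu)%card)
    (nuZ_product : is_product_measure nuZ)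
    (Sigma0_spec : is_as_spectrum mu (H_ T Tinv f) Sigma0)
    (Sigma1_spec : is_as_spectrum (mu \x nuZ)%E
       (fun xw psi => H_ T Tinv f xw.1 psi + W_ xw.2 psi) Sigma1)
    (X_connected : connected [set: X]) :
  Sigma1 = bigstar Sigma0 (msupport nu).
Proof.
have [cpt0 ae0] := Sigma0_spec; have [cpt1 ae1] := Sigma1_spec.
pose V (x : X) n := f (iterz T Tinv n x).
pose VW x (w : seqspace nu) n := V x n + \val (w n).
have [C VC] : exists C, forall x n, `|V x n| <= C.
  have cfT : {within [set: X], continuous f} by exact: continuous_subspaceT.
  have /compact_bounded[M [_ hM]] := continuous_compact cfT X_compact.
  exists (M + 1) => x n; apply: (hM (M + 1)); first by rewrite ltrDl.
  by exists (iterz T Tinv n x).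
have [a [b [Sa Sb aSb]]] := compact_minmax nu_compact (msupport_neq0 nu).
have Sval (w : seqspace nu) n : msupport nu (\val (w n)).
  by have /set_mem := valP (w n).
have bV x : bounded_pot (V x) by exists C.
have bw (w : seqspace nu) : bounded_pot (fun n => \val (w n)).
  exists (`|a| + `|b|) => n; have /andP[wa wb] := aSb _ (Sval w n).
  rewrite ler_norml (le_trans _ wa) ?(le_trans wb)//.
    by rewrite (le_trans (ler_norm b))// lerDr.
  by rewrite opprD (@le_trans _ _ (- `|a|)) ?gerDl ?oppr_le0// lerNl -normrN ler_norm.
have bVW x w : bounded_pot (VW x w) by exact: bounded_potD.
have Vcont n : continuous (fun x => V x n).
  move=> x; apply: (@continuous_comp X X R (iterz T Tinv n) f x).
    exact: iterz_continuous.
  exact: f_cont.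
have Vtr x k : exists y, forall n, V y n = V x (n + k).
  have [TK TK' _ _] := T_homeo.
  by have [y hy] := iterz_translate x k TK' TK; exists y => n; rewrite /V hy.
have near_V x N eta : 0 < eta -> exists U : set X, [/\ open U, U x &
    forall y, U y -> forall n, (zrank n < N)%N -> `|V x n - V y n| <= eta].
  move=> eta0; have := @pot_window R X V Vcont x N eta eta0.
  by rewrite /prop_near1 nbhsE => -[U [oU Ux] UV]; exists U; split.
have mu_gt0 (U : set X) x : open U -> U x -> (0 < mu U)%E.
  by move=> oU Ux; have /(_ U oU Ux) : msupport (X := X) mu x by rewrite mu_support.
have good0 (U : set X) x : open U -> U x ->
    exists2 y, U y & has_spectrum Sigma0 (V y).
  move=> oU Ux.
  have [y Uy sy] := ae_meets (borel_open_measurable oU) (mu_gt0 U x oU Ux) ae0.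
  by exists y => //; split=> // e; exact: spectrum_schrodinger.
have good1 (U : set X) x J (A : int -> set R) (w0 : seqspace nu) :
    open U -> U x -> uniq J -> (forall j, open (A j)) ->
    (forall j, A j (\val (w0 j))) -> exists y (w : seqspace nu),
    [/\ U y, forall j, j \in J -> A j (\val (w j)) & has_spectrum Sigma1 (VW y w)].
  move=> oU Ux uJ oA Aw0.
  have mA j : measurable (A j : set (measurableTypeR R)).
    exact: measurable_realfun.open_measurable.
  have mU := borel_open_measurable oU.
  have mC := coord_cylinder_measurable (nu := nu) J mA.
  have pos : (0 < (mu \x nuZ) (U `*`
      [set w : seqspace nu | forall j, j \in J -> A j (\val (w j))]))%E.
    rewrite product_measure1E//; apply: mule_gt0; first exact: mu_gt0 Ux.
    exact: coord_cylinder_gt0 nuZ_product uJ oA Aw0.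
  have [[y w] [Uy Aw] sy] := ae_meets (measurableX mU mC) pos ae1.
  exists y, w; split=> //; split=> // e; apply: spectrum_schrodinger => //.
  rewrite -sy; congr spectrum; apply/funext => psi; apply/funext => n.
  rewrite /schrodinger /= /H_ /W_ /mul_op /schrodinger /VW.
  by rewrite fctE /= rmorphD /= mulrDl addrA.
(* A set of full measure meets every open set, and every product of an open set
   with a cylinder: all potentials are limits of typical ones. *)
have lim0 x : pot_limit (has_spectrum Sigma0) (V x).
  exists (C + C) => N eta eta0; have [U [oU Ux UV]] := near_V x N eta eta0.
  have [y Uy hy] := good0 U x oU Ux; exists (V y); split=> // n; last exact: UV.
  by rewrite (le_trans (ler_normB _ _))// lerD.
have lim1 x w : pot_limit (has_spectrum Sigma1) (VW x w).
  exists (C + C + (b - a)) => N eta eta0.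
  have eta2 : 0 < eta / 2 by rewrite divr_gt0.
  have [U [oU Ux UV]] := near_V x N (eta / 2) eta2.
  pose A j : set R := ball (\val (w j)) (eta / 2).
  have [||y [w' [Uy Aw hy]]] := good1 U x (window N) A w oU Ux (window_uniq N).
  - by move=> j; exact: ball_open.
  - by move=> j; exact: ballxx.
  have VWE n : VW x w n - VW y w' n = V x n - V y n + (\val (w n) - \val (w' n)).
    by rewrite /VW opprD addrACA.
  exists (VW y w'); split=> // n => [|nN]; rewrite VWE;
    apply: (le_trans (ler_normD _ _)).
    apply: lerD; first by rewrite (le_trans (ler_normB _ _))// lerD.
    have /andP[wa wb] := aSb _ (Sval w n); have /andP[wa' wb'] := aSb _ (Sval w' n).
    by rewrite ler_distl; apply/andP; split; move: wa wb wa' wb'; clear; lra.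
  rewrite (splitr eta); apply: lerD; first exact: UV.
  by apply: ltW; have := Aw n; rewrite mem_window => /(_ nN).
have [x0 _ hx0] := good0 setT point openT I.
have [p [q [Sp Sq pSq]]] := compact_minmax cpt0 (spectrum_neq0 hx0).
have const_seq s (Ss : msupport nu s) : exists w : seqspace nu, forall n, \val (w n) = s.
  by exists (fun=> SigSub (mem_set Ss)).
(* A gap of Sigma1 at E is a gap, of one and the same width, for all sums. *)
have gap1 E : ~ Sigma1 E ->
    exists2 c, 0 < c & forall x w, gap (schro (fun n => VW x w n - E)) c.
  move=> SE; have [e S1e|d [d0 Sd]] := compact_away (E := E) (d := 0) cpt1.
    by rewrite normr_gt0 subr_eq0; apply: contra_not_neq SE => <-.
  have d2 : 0 < d / 2 by rewrite divr_gt0.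
  exists (d / 2) => // x w; apply: gap_of_spectrum (lim1 x w) _ => // [|e S1e].
    exact: ltW.
  by apply: lt_le_trans (Sd _ S1e); lra.
have notS0 E s : ~ Sigma1 E -> msupport nu s -> ~ Sigma0 (E - s).
  move=> /gap1[c c0 gc] /const_seq[w ws]; apply/hx0.2; exists c => //.
  rewrite (_ : (fun n => _ - _) = fun n => VW x0 w n - E)//.
  by apply/funext => n; rewrite /VW ws opprB; ring.
have dich E s s' : ~ Sigma1 E -> msupport nu s -> msupport nu s' -> s < s' ->
    forall e e', Sigma0 e -> E - s' < e < E - s -> Sigma0 e' -> E - s' < e' < E - s.
  move=> /gap1[c c0 gc] Ss Ss' ss'.
  apply: (spectrum_gap_dichotomy X_connected VC Vcont Vtr hx0 ss' c0) => x w.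
  pose w' : seqspace nu := fun n =>
    if w n then SigSub (mem_set Ss') else SigSub (mem_set Ss).
  rewrite (_ : (fun n => _ - E) = fun n => VW x w' n - E)//.
  by apply/funext => n; rewrite /VW /w'; case: (w n).
rewrite (bigstarE Sp Sq pSq Sa Sb aSb).
have [y1 [w1 [_ _ hw1]]] : exists y (w : seqspace nu), [/\ True,
  True & has_spectrum Sigma1 (VW y w)].
  have [y [w [_ _ h]]] := good1 setT x0 [::] (fun=> setT)
    (fun=> SigSub (mem_set Sa)) openT I isT (fun=> openT) (fun=> I).
  by exists y, w.
have pq : p <= q by have /andP[] := pSq _ Sq.
have ab : a <= b by have /andP[] := aSb _ Sb.
case: ifP => hd; apply/seteqP; split=> E /=.
- (* Each W has distance at most (b - a) / 2 from the constant (a + b) / 2. *)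
  move=> S1E; apply: contrapT => nE.
  pose m := (a + b) / 2; pose h := (b - a) / 2.
  have h0 : 0 <= h by rewrite /h; lra.
  have [e S0e|d [hd' Sd]] := compact_away (E := E - m) (d := h) cpt0.
    rewrite ltNge; apply/negP => he; apply: nE; exists e => //.
    by move: he; rewrite /h /m ler_norml; clear => /andP[? ?]; apply/andP; split; lra.
  apply: (hw1.2 E).1 => //; pose d2 := (h + d) / 2.
  have g1 : gap (schro (fun n => V y1 n - (E - m))) d2.
    apply: gap_of_spectrum (lim0 y1) _ => //.
      by rewrite divr_ge0// addr_ge0// ltW// (le_lt_trans h0).
    by move=> e /Sd; rewrite /d2; move: hd'; clear; lra.
  exists (d2 - h); first by rewrite /d2; move: hd'; clear; lra.
  rewrite (_ : (fun n => _ - E) =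
    fun n => V y1 n - (E - m) + (\val (w1 n) - m)); last first.
    by apply/funext => n; rewrite /VW; ring.
  apply: gap_add_small => // [|n]; first exact: bounded_potD (bounded_pot_cst _).
  have := aSb _ (Sval w1 n); rewrite /m /h ler_norml; clear => /andP[? ?].
  by apply/andP; split; lra.
- (* Sigma0 contains neither E - a nor E - b, so e lies in (E - b, E - a), which
     is too short to contain all of Sigma0. *)
  move=> [e S0e /andP[h1 h2]]; apply: contrapT => nE.
  have ne s : msupport nu s -> E - e != s.
    by move=> Ss; apply: contra_not_neq (notS0 E s nE Ss) => <-; rewrite subKr.
  have /andP[ae eb] : a < E - e < b.
    by rewrite !lt_neqAle h1 h2 (ne b Sb) eq_sym (ne a Sa).
  have alb := lt_trans ae eb.
  have eI : E - b < e < E - a.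
    by apply/andP; split; [rewrite ltrBlDr -ltrBlDl|rewrite ltrBrDr -ltrBrDl].
  have /andP[? _] := dich E a b nE Sa Sb alb e p S0e eI Sp.
  have /andP[_ ?] := dich E a b nE Sa Sb alb e q S0e eI Sq.
  by move: hd; rewrite leNgt => /negP; apply; lra.
- (* Each H has distance at most (q - p) / 2 from the constant (p + q) / 2. *)
  move=> S1E; apply: contrapT => nE.
  pose m := (p + q) / 2; pose h := (q - p) / 2.
  have h0 : 0 <= h by rewrite /h; lra.
  have [s Ss|d [hd' Sd]] := compact_away (E := E - m) (d := h) nu_compact.
    rewrite ltNge; apply/negP => hs; apply: nE; exists s => //.
    by move: hs; rewrite /h /m ler_norml; clear => /andP[? ?]; apply/andP; split; lra.
  apply: (hw1.2 E).1 => //; exists (d - h); first by rewrite subr_gt0.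
  rewrite (_ : (fun n => _ - E) =
    fun n => V y1 n - m + (\val (w1 n) - (E - m))); last first.
    by apply/funext => n; rewrite /VW; ring.
  apply: gap_add_large.
  - exact: bounded_potD (bounded_pot_cst _).
  - exact: bounded_potD (bounded_pot_cst _).
  - exact: le_trans h0 (ltW hd').
  - apply: nrm_of_spectrum (lim0 y1) _ => // e /pSq.
    by rewrite /m /h ler_norml; clear => /andP[? ?]; apply/andP; split; lra.
  - by move=> n; exact: Sd.
- (* E - s lies in a bounded gap of Sigma0. As S is longer than Sigma0, either
     E - a > q or E - b < p; but then the interval between this point and E - s
     contains one end of Sigma0 and not the other. *)
  move/negbT: hd; rewrite -ltNge => hd.
  move=> [s Ss /andP[h1 h2]]; apply: contrapT => nE.
  have ne e : Sigma0 e -> E - s != e.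
    by move=> S0e; apply: contra_not_neq (notS0 E s nE Ss) => ->.
  have /andP[h1' h2'] : p < E - s < q.
    by rewrite !lt_neqAle h1 h2 (ne q Sq) eq_sym (ne p Sp).
  have /andP[? ?] := aSb _ Ss.
  have [hq|hq] := ltP q (E - a).
    have sa : a < s by lra.
    have eI : E - s < q < E - a by rewrite h2' hq.
    have /andP[H _] := dich E a s nE Sa Ss sa q p Sq eI Sp.
    by have := lt_trans H h1'; rewrite ltxx.
  have sb : s < b by lra.
  have eI : E - b < p < E - s by rewrite h1' andbT; move: hq hd; clear; lra.
  have /andP[_ H] := dich E s b nE Ss Sb sb p q Sp eI Sq.
  by have := lt_trans H h2'; rewrite ltxx.
Qed.
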